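(* Let $d\ge 2$ and let $\{e_i\}_{i\ge1}$ be the nearest-neighbour edges of $\mathbb{Z}^d$. Let $\{t(e_i)\}_{i\ge1}$ be independent and identically distributed nonnegative real random variables such that (i) $\sup_i \mathbb{P}(t(e_i)<\epsilon)\to 0$ as $\epsilon\downarrow 0$; (ii) there exists a constant $\eta>0$ with $\sup_i \mathbb{E}\left[t(e_i)^{6(1+d)+\eta}\right]<\infty$. For $n\ge1$ let $T(0,n)$ be the minimum passage time from the origin to $(n,\mathbf{0})$. Then there exists a (deterministic) constant $\mu>0$ such that $$\frac{T(0,n)}{n}\longrightarrow \mu\quad\text{almost surely and in }L^2$$ as $n\to\infty$.
   Context: $\mathbf{0}$ denotes the $(d-1)$-dimensional zero vector, so $(n,\mathbf{0})\in\mathbb{Z}^d$ and the origin is $(0,\mathbf{0})$. For a finite nearest-neighbour path $\pi$ in $\mathbb{Z}^d$ with (distinct) edges $h_1,\dots,h_k$, its passage time is $T(\pi)=\sum_{j=1}^k t(h_j)$. $T(0,n)$ is the shortest passage time of a path from $(0,\mathbf{0})$ to $(n,\mathbf{0})$, i.e. the infimum of $T(\pi)$ over all finite paths $\pi$ from $(0,\mathbf{0})$ to $(n,\mathbf{0})$ (under the hypotheses this infimum is almost surely attained). *)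

(* Defs.v *)
From HB Require Import structures.
From mathcomp Require Import all_boot all_order all_algebra.
From mathcomp Require Import all_classical all_reals all_analysis.

Set Implicit Arguments.
Unset Strict Implicit.
Unset Printing Implicit Defensive.

Import Order.TTheory GRing.Theory Num.Theory.
Import numFieldNormedType.Exports.

Local Open Scope classical_set_scope.
Local Open Scope ring_scope.

Section lattice.
Variable d : nat.

Definition lattice := 'rV[int]_d.

(* The pair (x, i) stands for the undirected edge {x, x + u_i}, with u_i the
   i-th unit vector; see [joins_nearest_neighbour]. *)
Definition edge := (lattice * 'I_d)%type.

Definition joins (e : edge) (x y : lattice) : bool :=
  let z := e.1 + delta_mx 0 e.2 in
  ((x == e.1) && (y == z)) || ((y == e.1) && (x == z)).

(* [h] lists, in order, the edges traversed by a path from [x] to [y]. *)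
Fixpoint connects (x : lattice) (h : seq edge) (y : lattice) : Prop :=
  if h is e :: h' then exists2 z, joins e x z & connects z h' y else x = y.

(* A path never uses the same edge twice. *)
Definition is_path (x y : lattice) (h : seq edge) : Prop :=
  uniq h /\ connects x h y.

(* The vertex (n, 0, ..., 0). *)
Definition axis_point (n : nat) : lattice :=
  \row_(i < d) (if val i == 0%N then n%:Z else 0).

Lemma joins_nearest_neighbour (x y : lattice) :
  (\sum_(i < d) `|x 0%R i - y 0%R i|)%N = 1%N <-> exists! e : edge, joins e x y.
Proof.
have dE (z : lattice) i k : (z + delta_mx 0 i) 0 k = z 0 k + (k == i)%:R.
  by rewrite !mxE.
split.
- move=> h1; pose D i := `|x 0%R i - y 0%R i|%N.
  have [i Di0] : exists i, D i != 0%N.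
    apply/existsP; rewrite -negb_forall; apply/negP => /forallP D0.
    by move: h1; rewrite big1// => i _; exact/eqP/D0.
  move: (h1); rewrite (bigD1 i)//= -/(D i) => h2.
  have Di1 : D i = 1%N by move: h2 Di0; case: (D i) => [|[|m]].
  have Dk k : k != i -> x 0 k = y 0 k.
    move=> ki; move: h2; rewrite Di1 => -[] /eqP.
    rewrite sum_nat_eq0 => /forallP/(_ k); rewrite ki/= absz_eq0 subr_eq0.
    by move/eqP.
  have uni (e e' : edge) : joins e x y -> joins e' x y -> e = e'.
    move: e e' => [a j] [b k]; rewrite /joins/=.
    have add0 (u : lattice) l m : u + delta_mx 0 l + delta_mx 0 m <> u.
      move=> /rowP/(_ l); rewrite !dE eqxx/= -addrA => /eqP.
      by rewrite -subr_eq0 addrAC subrr add0r; case: (l == m).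
    have dI (u : lattice) l m : u + delta_mx 0 l = u + delta_mx 0 m -> l = m.
      move=> /addrI/rowP/(_ l); rewrite !mxE !eqxx/=.
      by case: (eqVneq l m).
    case/orP => /andP[/eqP-> /eqP->] /orP[] /andP[/eqP E1 /eqP E2].
    + by move: E2; rewrite -E1 => /dI ->.
    + by case: (add0 a j k); rewrite E1 E2.
    + by case: (add0 a j k); rewrite E1 E2.
    + by move: E2; rewrite -E1 => /dI ->.
  suff [e je] : exists e, joins e x y.
    by exists e; split=> // e' je'; exact: uni je je'.
  have [xy|xy] : x 0 i = y 0 i + 1 \/ y 0 i = x 0 i + 1.
  + have : `|x 0 i - y 0 i| = 1 by rewrite -abszE -/(D i) Di1.
    case: (lerP 0 (x 0 i - y 0 i)) => hs.
    * by rewrite ger0_norm// => /eqP; rewrite subr_eq addrC => /eqP; left.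
    * rewrite ltr0_norm// opprB => /eqP.
      by rewrite subr_eq addrC => /eqP; right.
  + exists (y, i); rewrite /joins/= eqxx/=; apply/orP; right.
    apply/eqP/rowP => k; rewrite dE; have [->//|ki] := eqVneq k i.
    by rewrite addr0 Dk.
  + exists (x, i); rewrite /joins/= eqxx/=; apply/orP; left.
    apply/eqP/rowP => k; rewrite dE; have [->//|ki] := eqVneq k i.
    by rewrite addr0 Dk.
- case=> -[a i] [je _].
  have -> : (\sum_(k < d) `|x 0%R k - y 0%R k| = \sum_(k < d) (k == i))%N.
    apply: eq_bigr => k _; move: je; rewrite /joins/=.
    case/orP => /andP[/eqP-> /eqP->]; rewrite dE.
      by rewrite opprD addrA subrr add0r abszN; case: (k == i).
    by rewrite addrAC subrr add0r; case: (k == i).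
  rewrite (bigD1 i)//= eqxx big1// => k /negbTE ->//.
Qed.

End lattice.

Section passage_time.
Variables (d : nat) (Omega : Type) (R : realType).
Variable t : edge d -> Omega -> R.

Definition path_time (h : seq (edge d)) (w : Omega) : R := \sum_(e <- h) t e w.

(* The real infimum [inf] is the genuine one when [t] is nonnegative, since
   every two vertices are then joined by a path and 0 is a lower bound. *)
Definition passage_time (n : nat) (w : Omega) : R :=
  inf [set path_time h w | h in is_path (axis_point d 0) (axis_point d n)].

End passage_time.

Section random_variables.
Context d (T : measurableType d) (R : realType) (P : probability T R).

Definition mutually_independent (I : eqType) (X : I -> {RV P >-> R}) : Prop :=
  forall (s : seq I) (B : I -> set R),
    uniq s -> (forall i, measurable (B i)) ->
    P (\bigcap_(i in [set` s]) X i @^-1` B i) =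
    (\prod_(i <- s) P (X i @^-1` B i))%E.

Definition identically_distributed (I : Type) (X : I -> {RV P >-> R}) : Prop :=
  forall (i j : I) (B : set R), measurable B ->
    distribution P (X i) B = distribution P (X j) B.

Definition cvg_almost_surely (u : nat -> T -> R) (f : T -> R) : Prop :=
  {ae P, forall w, u n w @[n --> \oo] --> f w}.

Definition cvg_L2 (u : nat -> T -> R) (f : T -> R) : Prop :=
  [/\ forall n, u n \in Lfun P 2%:E,
      f \in Lfun P 2%:E &
      ('N[P]_2%:E[EFin \o (u n \- f)%R])%E @[n --> \oo] --> 0%E].

End random_variables.

(* Main.v *)
Require Import Defs.
From HB Require Import structures.
From mathcomp Require Import all_boot all_order all_algebra.
From mathcomp Require Import all_classical all_reals all_analysis.
From mathcomp Require Import measurable_realfun zify ring lra.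

(** Let T_n be the passage time from the origin to (n, 0). Its mean is shown to
    be asymptotically linear and its variance at most linear; the two limits
    follow from these facts and from Chebyshev-type estimates.

    Mean. A path to (m, 0) followed by a path from (m, 0) to (m + n, 0) is, up
    to the removal of loops, a path to (m + n, 0), and the law of the weights is
    invariant under translations. Hence E T_n is subadditive and E T_n / n has a
    limit mu ([fekete], [mean_subadditive]). Positivity of mu is a Peierls
    argument. If m distinct edges have total weight below eps m / 2, then more
    than half of them have weight below eps. There are at most (2 d)^m paths of
    m edges from the origin and at most 2^m choices of the light edges, so such
    a path exists with probability at most (4 d)^m P(t < eps)^(m / 2), which is
    geometrically small for a suitable eps. Therefore, up to an integrable error
    ([light_excess]), the number of edges of every path from the origin is at
    most 2 / eps times its weight ([path_size_le]); a path to (n, 0) has at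
    least n edges, whence [mean_lower].

    Variance. By the Efron-Stein inequality ([efron_stein]) the variance is
    controlled by the effect of replacing the weight of a single edge by an
    independent copy. Such a replacement can increase T_n only if the edge lies
    on the optimal path, and then by at most the new weight. Summed over the
    edges, this bounds the variance by a multiple of E t^2 times the mean number
    of edges of the optimal path ([variance_best_le]), and the latter is at most
    linear in n by the Peierls estimate again. The inequality is proved for
    minima over finite lists of paths, which converge to T_n
    ([cvg_fpt_approx]); Fatou's lemma passes to the limit.

    Conclusion. The bound Var (T_n / n) = O(1 / n) gives convergence in L^2. It
    is summable along n = k^2, so that T_n / n converges almost surely along the
    squares. Between k^2 and (k + 1)^2 the passage time varies by at most the
    weight of a straight segment of 2 k edges, and this is negligible with
    respect to k^2 for the same reason ([cvg_along_squares],
    [ae_cvg_passage]). *)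

Set Implicit Arguments.
Unset Strict Implicit.
Unset Printing Implicit Defensive.

Import Order.TTheory GRing.Theory Num.Theory.
Import numFieldNormedType.Exports.
Local Open Scope classical_set_scope.
Local Open Scope ring_scope.

(** * Laws on the space of configurations *)

(** These sets are stable under intersection and generate the product
    sigma-algebra, so a law on configurations is determined by its
    finite-dimensional marginals; this is how two families of weights are
    compared below. *)
Definition cylinders (I : choiceType) (R : realType) : set_system (I -> R) :=
  [set C | exists (s : seq I) (B : I -> set R),
     (forall i, measurable (B i)) /\
     C = \bigcap_(i in [set` s]) [set x | B i (x i)]].

Arguments cylinders : clear implicits.

Definition config (I : choiceType) (R : realType) : Type := I -> R.

HB.instance Definition _ (I : choiceType) (R : realType) :=
  Measurable.copy (config I R) (g_sigma_algebraType (cylinders I R)).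

Lemma cylindersI (I : choiceType) (R : realType) :
  setI_closed (cylinders I R).
Proof.
move=> _ _ [s1 [B1 [mB1 ->]]] [s2 [B2 [mB2 ->]]].
exists (s1 ++ s2), (fun i => (if i \in s1 then B1 i else setT) `&`
                             (if i \in s2 then B2 i else setT)); split.
  by move=> i; apply: measurableI; case: ifP.
apply/seteqP; split=> x /=.
  by move=> [x1 x2] i /= _; split; case: ifP => // ?; [exact: x1|exact: x2].
move=> xB; split=> i /= is_; have := xB i; rewrite /= mem_cat is_ ?orbT.
  by move=> /(_ isT)[].
by move=> /(_ isT)[].
Qed.

Lemma measurable_coord (I : choiceType) (R : realType) (i : I) :
  measurable_fun [set: config I R] (fun x : config I R => x i).
Proof.
move=> _ B mB; rewrite setTI; apply: sub_sigma_algebra.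
exists [:: i], (fun=> B); split=> //; apply/seteqP; split => x /=.
  by move=> xB j /=; rewrite inE => /eqP ->.
by move=> /(_ i) /=; rewrite inE eqxx; exact.
Qed.

Lemma bigcap_seq_measurable (I : choiceType) d (T : measurableType d)
    (s : seq I) (A : I -> set T) :
  (forall i, measurable (A i)) -> measurable (\bigcap_(i in [set` s]) A i).
Proof.
by move=> mA; rewrite bigcap_seq; apply: bigsetI_measurable => i _.
Qed.

Lemma measurable_config (I : choiceType) (R : realType) d
    (T : measurableType d) (X : T -> config I R) :
  (forall i, measurable_fun setT (X ^~ i)) -> measurable_fun setT X.
Proof.
move=> mX; apply: (@measurability _ _ T (config I R) setT X (cylinders I R) erefl).
move=> _ [_ [s [B [mB ->]]] <-]; rewrite setTI preimage_bigcap.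
apply: bigcap_seq_measurable => i; rewrite -[X in measurable X]setTI.
exact: mX.
Qed.

(** Both laws are finite measures that agree on the cylinders, hence on the
    whole product sigma-algebra by the pi-lambda theorem. *)
Lemma eq_law_integral (I : choiceType) (R : realType)
    d1 (T1 : measurableType d1) (mu1 : {measure set T1 -> \bar R})
    d2 (T2 : measurableType d2) (mu2 : {measure set T2 -> \bar R})
    (X : T1 -> config I R) (Y : T2 -> config I R) (F : config I R -> \bar R) :
  (forall i, measurable_fun setT (X ^~ i)) ->
  (forall i, measurable_fun setT (Y ^~ i)) ->
  (mu1 setT < +oo)%E ->
  (forall (s : seq I) (B : I -> set R), uniq s ->
     (forall i, measurable (B i)) ->
     mu1 (\bigcap_(i in [set` s]) (X ^~ i) @^-1` B i) =
     mu2 (\bigcap_(i in [set` s]) (Y ^~ i) @^-1` B i)) ->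
  measurable_fun setT F -> (forall x, 0 <= F x)%E ->
  (\int[mu1]_w F (X w) = \int[mu2]_w F (Y w))%E.
Proof.
move=> mX mY mu1oo XY mF F0.
have {}mX := measurable_config mX.
have {}mY := measurable_config mY.
transitivity (\int[pushforward mu1 X]_x F x)%E.
  by rewrite [RHS]ge0_integral_pushforward//= => x _; exact: F0.
transitivity (\int[pushforward mu2 Y]_x F x)%E; last first.
  by rewrite [LHS]ge0_integral_pushforward//= => x _; exact: F0.
apply: eq_measure_integral => A mA _.
apply: (@g_sigma_algebra_measure_unique _ R (config I R) (cylinders I R) _
  (fun=> setT)) => //.
- exact: sub_sigma_algebra.
- move=> _; exists [::], (fun=> setT); split => //.
  by rewrite set_nil bigcap_set0.
- by rewrite bigcup_const.
- exact: cylindersI.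
- move=> _ [s [B [mB ->]]]; rewrite /= /pushforward !preimage_bigcap.
  have -> : [set` s] = [set` undup s].
    by apply/seteqP; split=> i /=; rewrite mem_undup.
  exact: XY (undup_uniq s) mB.
Qed.

(** The common law [nu] enters only through the product formula, which makes
    the property manifestly stable under injective reindexing and under taking
    an independent copy. *)
Definition iid (I : choiceType) (R : realType) d (T : measurableType d)
    (mu : set T -> \bar R) (nu : set R -> \bar R) (X : T -> config I R) :=
  (forall i, measurable_fun setT (X ^~ i)) /\
  forall (s : seq I) (B : I -> set R), uniq s -> (forall i, measurable (B i)) ->
    mu (\bigcap_(i in [set` s]) (X ^~ i) @^-1` B i) =
    (\prod_(i <- s) nu (B i))%E.

Lemma iid_setT (I : choiceType) (R : realType) d (T : measurableType d)
    (mu : set T -> \bar R) (nu : set R -> \bar R) (X : T -> config I R) :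
  iid mu nu X -> mu setT = 1%E.
Proof.
move=> [_ /(_ [::] (fun=> setT) isT)].
by rewrite set_nil bigcap_set0 big_nil; exact.
Qed.

Lemma iid_reindex (I J : choiceType) (R : realType) d (T : measurableType d)
    (mu : set T -> \bar R) (nu : set R -> \bar R) (X : T -> config I R)
    (f : J -> I) (g : I -> J) :
  cancel f g -> iid mu nu X -> iid mu nu (fun w j => X w (f j)).
Proof.
move=> fK [mX iX]; split=> [j|s B us mB]; first exact: mX.
have /= := iX (map f s) (B \o g) _ (fun i => mB (g i)).
rewrite map_inj_uniq ?us; last exact: can_inj fK.
move=> /(_ isT); rewrite big_map.
under [in RHS]eq_bigr do rewrite fK.
move=> <-; congr mu; apply/seteqP; split=> w /= wB.
  by move=> _ /= /mapP[j js ->]; rewrite fK; exact: wB.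
by move=> j /= js; have := wB (f j) (map_f f js); rewrite /= fK.
Qed.

(** The source of every invariance below: translations of the lattice and
    exchanges of a weight with its independent copy are both reindexings. *)
Lemma iid_integral_reindex (I : choiceType) (R : realType) d
    (T : measurableType d) (mu : {measure set T -> \bar R})
    (nu : set R -> \bar R) (X : T -> config I R) (f g : I -> I)
    (F : config I R -> \bar R) :
  cancel f g -> iid mu nu X ->
  measurable_fun setT F -> (forall x, 0 <= F x)%E ->
  (\int[mu]_w F (fun i => X w (f i)) = \int[mu]_w F (X w))%E.
Proof.
move=> fK iX mF F0; have iXf := iid_reindex fK iX.
apply: eq_law_integral => //; [exact: iXf.1|exact: iX.1| |].
  by rewrite (iid_setT iX) ltry.
by move=> s B us mB; rewrite (iXf.2 s B us mB) (iX.2 s B us mB).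
Qed.

(** On the product space, [(i, false)] is the weight of [i] and [(i, true)] its
    independent copy. *)
Definition two_copies (I : choiceType) (R : realType) T (X : T -> config I R)
    (z : T * T) : config (I * bool)%type R :=
  fun p => if p.2 then X z.2 p.1 else X z.1 p.1.

Lemma iid_two_copies (I : choiceType) (R : realType) d (T : measurableType d)
    (P : probability T R) (nu : set R -> \bar R) (X : T -> config I R) :
  iid P nu X -> iid (P \x P)%E nu (two_copies X).
Proof.
move=> [mX iX]; split=> [[i []]|s B us mB].
- exact: measurableT_comp (mX i) measurable_snd.
- exact: measurableT_comp (mX i) measurable_fst.
(* The two copies are constrained separately: the event is a rectangle. *)
pose sb b := [seq p.1 | p <- s & p.2 == b].
pose A b := \bigcap_(i in [set` sb b]) (X ^~ i) @^-1` B (i, b).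
have mA b : measurable (A b).
  apply: bigcap_seq_measurable => i.
  by rewrite -[X in measurable X]setTI; exact: mX.
have -> : \bigcap_(i in [set` s]) (two_copies X ^~ i) @^-1` B i =
    A false `*` A true.
  apply/seteqP; split=> -[w w'] /=.
    move=> wB; split=> i /= /mapP[[j b]]; rewrite mem_filter /= => /andP[].
      by move=> /eqP -> js ->; exact: (wB _ js).
    by move=> /eqP -> js ->; exact: (wB _ js).
  move=> [w1 w2] [i []] /= ps.
    apply: w2; apply/mapP; exists (i, true) => //.
    by rewrite mem_filter eqxx.
  apply: w1; apply/mapP; exists (i, false) => //.
  by rewrite mem_filter eqxx.
have PA b : P (A b) = (\prod_(p <- s | p.2 == b) nu (B p))%E.
  rewrite /A (iX (sb b) (fun i => B (i, b))) //; last first.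
    rewrite map_inj_in_uniq ?filter_uniq // => -[i c] [j c'].
    by rewrite !mem_filter /= => /andP[/eqP -> _] /andP[/eqP -> _] ->.
  rewrite big_map big_filter; apply: eq_bigr => -[i c] /= /eqP -> //.
transitivity (P (A false) * P (A true))%E; first exact: product_measure1E.
by rewrite !PA [RHS](bigID (fun p => p.2 == false))/=;
  congr (_ * _)%E; apply: eq_bigl => -[i []].
Qed.

(** * The Efron-Stein inequality *)

(** The weights in [A] are resampled, the others are kept. *)
Definition mix (I : choiceType) (R : realType) (A : pred I)
  (z : config (I * bool)%type R) : config I R := fun i => z (i, A i).

Section resampling.
Context (I : choiceType) (R : realType) d (T : measurableType d).
Variables (P : probability T R) (nu : set R -> \bar R) (X : T -> config I R).
Hypothesis iX : iid P nu X.
Variable f : config I R -> R.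
Hypothesis mf : measurable_fun setT f.

Definition sqdist (A B : pred I) : \bar R :=
  (\int[(P \x P)%E]_z
    ((f (mix A (two_copies X z)) - f (mix B (two_copies X z))) ^+ 2)%:E)%E.

Lemma measurable_mix (A : pred I) :
  measurable_fun setT (mix A : config (I * bool)%type R -> config I R).
Proof. by apply: measurable_config => i; exact: measurable_coord. Qed.

Lemma measurable_two_copies : measurable_fun setT (two_copies X).
Proof. by apply: measurable_config; exact: (iid_two_copies iX).1. Qed.

Lemma measurable_sqdist_integrand (A B : pred I) : measurable_fun setT
  (fun y => ((f (mix A y) - f (mix B y)) ^+ 2)%:E).
Proof.
apply/measurable_EFinP/measurable_funX/measurable_funB.
  exact: measurableT_comp mf (measurable_mix A).
exact: measurableT_comp mf (measurable_mix B).
Qed.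

Lemma measurable_sqdist (A B : pred I) : measurable_fun setT
  (fun z => ((f (mix A (two_copies X z)) - f (mix B (two_copies X z))) ^+ 2)%:E).
Proof.
exact: measurableT_comp (measurable_sqdist_integrand A B) measurable_two_copies.
Qed.

(** Exchanging the two copies on [A] preserves the law, turns [mix A] into the
    original weights and [mix B] into the weights resampled on the symmetric
    difference. *)
Lemma sqdist_xor (A B C : pred I) : (forall i, C i = A i (+) B i) ->
  sqdist A B = sqdist pred0 C.
Proof.
move=> CE; rewrite /sqdist.
pose s (p : I * bool) := (p.1, p.2 (+) A p.1).
have sK : cancel s s by move=> [i b]; rewrite /s /= addbK.
pose F y := ((f (mix pred0 y) - f (mix C y)) ^+ 2)%:E.
rewrite -(@iid_integral_reindex _ _ _ _ _ _ _ s s F sK (iid_two_copies iX)).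
- apply: eq_integral => z _; rewrite /F; set y := two_copies X z.
  have -> : mix pred0 (y \o s) = mix A y by apply/funext.
  suff -> : mix C (y \o s) = mix B y by [].
  by apply/funext => i; rewrite /mix /s /= CE addbC addKb.
- exact: measurable_sqdist_integrand.
- by move=> y; rewrite lee_fin sqr_ge0.
Qed.

(** Four points [a, b, c, e] of the line satisfy the quadrilateral inequality
    (a - e)^2 + (b - c)^2 <= (a - b)^2 + (c - e)^2 + (a - c)^2 + (b - e)^2,
    because the difference of both sides is (a - b - c + e)^2. Apply it to the
    values of [f] at the original weights and at the weights resampled on [A],
    on [B] and on both: by [sqdist_xor] the two terms on the left have the same
    mean, and the four terms on the right pair up likewise. *)
Lemma sqdistU (A B C : pred I) : (forall i, ~~ (A i && B i)) ->
  (forall i, C i = A i || B i) ->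
  (sqdist pred0 C <= sqdist pred0 A + sqdist pred0 B)%E.
Proof.
move=> AB CE.
have s0 A' B' : (0 <= sqdist A' B')%E.
  by apply: integral_ge0 => z _; rewrite lee_fin sqr_ge0.
suff : (sqdist pred0 C + sqdist A B <=
    (sqdist pred0 A + sqdist B C) + (sqdist pred0 B + sqdist A C))%E.
  rewrite (@sqdist_xor A B C); last first.
    by move=> i; rewrite CE; move: (AB i); case: (A i) (B i) => -[].
  rewrite (@sqdist_xor B C A); last first.
    by move=> i; rewrite CE; move: (AB i); case: (A i) (B i) => -[].
  rewrite (@sqdist_xor A C B); last first.
    by move=> i; rewrite CE; move: (AB i); case: (A i) (B i) => -[].
  rewrite [leRHS]addeACA -2!mule2n -2!mule_natl lee_pmul2l //.
pose g A' B' z :=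
  ((f (mix A' (two_copies X z)) - f (mix B' (two_copies X z))) ^+ 2)%:E.
have mg A' B' : measurable_fun setT (g A' B') by exact: measurable_sqdist.
have g0 A' B' z : (0 <= g A' B' z)%E by rewrite lee_fin sqr_ge0.
have gD A1 B1 A2 B2 : (sqdist A1 B1 + sqdist A2 B2 =
    \int[(P \x P)%E]_z (g A1 B1 z + g A2 B2 z))%E.
  by rewrite ge0_integralD.
rewrite !gD -ge0_integralD//; last 4 first.
- by move=> z _; exact: adde_ge0.
- exact: emeasurable_funD.
- by move=> z _; exact: adde_ge0.
- exact: emeasurable_funD.
apply: ge0_le_integral => //.
- by move=> z _; exact: adde_ge0.
- exact: emeasurable_funD.
- by apply: emeasurable_funD; exact: emeasurable_funD.
move=> z _; rewrite /g -!EFinD lee_fin.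
set a := f (mix pred0 _); set b := f (mix A _).
set c := f (mix B _); set e := f (mix C _).
have -> : (a - b) ^+ 2 + (c - e) ^+ 2 + ((a - c) ^+ 2 + (b - e) ^+ 2) =
    (a - e) ^+ 2 + (b - c) ^+ 2 + (a - b - c + e) ^+ 2 by ring.
by rewrite lerDl sqr_ge0.
Qed.

Lemma sqdist_seq (s : seq I) : uniq s ->
  (sqdist pred0 (mem s) <= \sum_(i <- s) sqdist pred0 (pred1 i))%E.
Proof.
elim: s => [_|i s ih /= /andP[is_ us]].
  rewrite big_nil le_eqVlt; apply/orP; left; apply/eqP.
  by rewrite /sqdist; apply: integral0_eq => z _; rewrite subrr expr0n.
rewrite big_cons; apply: (@le_trans _ _
    (sqdist pred0 (pred1 i) + sqdist pred0 (mem s))%E).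
  apply: sqdistU => j /=; last by rewrite inE.
  by case: eqP => //= ->.
by rewrite leeD2l// ih.
Qed.

(** The left-hand side is twice the variance of [f] when [f] is
    square-integrable. It is the effect of resampling all of [s], which
    subadditivity ([sqdistU]) reduces to the effect of resampling one index. *)
Theorem efron_stein (s : seq I) : uniq s ->
  (forall x y, {in s, x =1 y} -> f x = f y) ->
  (\int[(P \x P)%E]_z ((f (X z.1) - f (X z.2)) ^+ 2)%:E <=
   \sum_(i <- s) sqdist pred0 (pred1 i))%E.
Proof.
move=> us fs; apply: le_trans (sqdist_seq us).
rewrite le_eqVlt; apply/orP; left; apply/eqP.
apply: eq_integral => z _.
rewrite (fs (mix (mem s) (two_copies X z)) (X z.2)) // => i is_.
by rewrite /mix /two_copies /=; case: ifPn => // /negP[].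
Qed.

End resampling.

(** * The variance of a minimum over finitely many paths *)

Section minimal_path.
Context (I : choiceType) (R : realType).
Implicit Types (x y : config I R) (h : seq I) (l : seq (seq I)).

Definition weight x h : R := \sum_(e <- h) x e.

(** A minimizer of the weight among [h0 :: l]. Selecting it by recursion on the
    list breaks ties in a measurable way ([measurable_best]). *)
Fixpoint best (h0 : seq I) l x : seq I :=
  if l is h :: l' then
    let b := best h0 l' x in if weight x h <= weight x b then h else b
  else h0.

Lemma best_mem h0 l x : best h0 l x \in h0 :: l.
Proof.
elim: l => [|h l ih] /=; first by rewrite inE.
case: ifP => _; first by rewrite !inE eqxx orbT.
by move: ih; rewrite !inE => /orP[->|->]; rewrite ?orbT.
Qed.

Lemma best_min h0 l x h : h \in h0 :: l -> weight x (best h0 l x) <= weight x h.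
Proof.
elim: l => [|h' l ih] /=; first by rewrite inE => /eqP ->.
rewrite !inE orbCA => /orP[/eqP ->|hl]; case: ifPn => // hb.
- by rewrite ltW // ltNge.
- by apply: le_trans hb (ih _); rewrite inE.
- by apply: ih; rewrite inE.
Qed.

Lemma measurable_weight h :
  measurable_fun setT (fun x : config I R => weight x h).
Proof. by apply: measurable_sum => e; exact: measurable_coord. Qed.

Lemma measurable_best (phi : config I R -> seq I -> R) h0 l :
  (forall h, measurable_fun setT (phi ^~ h)) ->
  measurable_fun setT (fun x => phi x (best h0 l x)).
Proof.
move=> mphi; elim: l phi mphi => [|h l ih] phi mphi /=; first exact: mphi.
rewrite (_ : (fun x => _) = fun x =>
    if weight x h <= weight x (best h0 l x) then phi x h
    else phi x (best h0 l x)); last by apply/funext => x; case: ifP.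
apply: measurable_fun_ifT; [|exact: mphi|exact: ih].
apply: measurable_fun_ler; first exact: measurable_weight.
by apply: (ih weight); exact: measurable_weight.
Qed.

Lemma measurable_best_comp d (T : measurableType d) (g : T -> config I R)
    (phi : seq I -> R) h0 l : measurable_fun setT g ->
  measurable_fun setT (fun w => phi (best h0 l (g w))).
Proof.
apply: (@measurableT_comp _ _ _ _ _ _ (fun x => phi (best h0 l x))).
exact: (@measurable_best (fun=> phi)).
Qed.

Lemma weight_change1 x y e h : uniq h -> 0 <= x e ->
  (forall i, i != e -> y i = x i) ->
  weight y h <= weight x h + y e *+ (e \in h).
Proof.
move=> uh xe yx; rewrite /weight.
have Eh (eh : e \notin h) : \sum_(i <- h) y i = \sum_(i <- h) x i.
  rewrite !big_seq; apply: eq_bigr => i ih; apply: yx.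
  by apply: contraNneq eh => <-.
have [eh|eh] := boolP (e \in h); last by rewrite Eh // mulr0n addr0.
rewrite !(bigD1_seq e) //= mulr1n [leRHS]addrC lerD2l.
rewrite (eq_bigr x) ?lerDr // => i; exact: yx.
Qed.

(** The path that was optimal for [x] is still available for [y], and its
    weight has increased by at most [y e], and only if it goes through [e]. *)
Lemma weight_best_change1 x y e h0 l : all uniq (h0 :: l) -> 0 <= x e ->
  (forall i, i != e -> y i = x i) ->
  weight y (best h0 l y) <=
  weight x (best h0 l x) + y e *+ (e \in best h0 l x).
Proof.
move=> ul xe yx; apply: le_trans (best_min y (best_mem h0 l x)) _.
apply: weight_change1 => //; exact: (allP ul) (best_mem _ _ _).
Qed.

(** If the minimum increases from [x] to [y], [weight_best_change1] bounds the
    increase by the first term; if it decreases, exchange [x] and [y]. *)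
Lemma sqr_weight_best_change1 x y e h0 l : all uniq (h0 :: l) ->
  0 <= x e -> 0 <= y e -> (forall i, i != e -> y i = x i) ->
  (weight x (best h0 l x) - weight y (best h0 l y)) ^+ 2 <=
  y e ^+ 2 *+ (e \in best h0 l x) + x e ^+ 2 *+ (e \in best h0 l y).
Proof.
move=> ul xe ye yx.
have hy := weight_best_change1 ul xe yx.
have hx := weight_best_change1 ul ye (fun i ie => esym (yx i ie)).
have sq (a b c : R) (p : bool) : a <= b -> b <= a + c *+ p ->
    (b - a) ^+ 2 <= c ^+ 2 *+ p.
  move=> ab; case: p; rewrite ?mulr1n ?mulr0n ?addr0 => bc.
    by rewrite lerXn2r ?nnegrE; lra.
  by have -> : b = a by [lra]; rewrite subrr expr0n.
case: (leP (weight x (best h0 l x)) (weight y (best h0 l y))) => [le|/ltW le].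
  rewrite -sqrrN opprB (le_trans (sq _ _ _ _ le hy)) // lerDl.
  by rewrite mulrn_wge0 // sqr_ge0.
rewrite (le_trans (sq _ _ _ _ le hx)) // lerDr.
by rewrite mulrn_wge0 // sqr_ge0.
Qed.

Lemma sum_mem_le_size (s h : seq I) : uniq s ->
  \sum_(e <- s) (e \in h)%:R <= (size h)%:R :> R.
Proof.
move=> us; rewrite -natr_sum ler_nat.
have -> : (\sum_(e <- s) (e \in h) = size [seq e <- s | e \in h])%N.
  by rewrite size_filter -sum1_count [RHS]big_mkcond; apply: eq_bigr => e _; case: ifP.
apply: uniq_leq_size; first exact: filter_uniq.
by move=> e; rewrite mem_filter => /andP[].
Qed.

End minimal_path.

Section variance.
Context (I : choiceType) (R : realType) d (T : measurableType d).
Variables (P : probability T R) (nu : set R -> \bar R) (X : T -> config I R).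
Hypothesis iX : iid P nu X.
Hypothesis X0 : forall w i, 0 <= X w i.
Variable M : R.
Hypothesis M0 : 0 <= M.
Hypothesis XM : forall i, (\int[P]_w ((X w i) ^+ 2)%:E <= M%:E)%E.
Variables (h0 : seq I) (l : seq (seq I)).
Hypothesis ul : all uniq (h0 :: l).

Let f (x : config I R) := weight x (best h0 l x).

Lemma measurable_weight_best : measurable_fun setT f.
Proof. exact: (measurable_best _ _ (@measurable_weight I R)). Qed.

Lemma measurable_iid : measurable_fun setT X.
Proof. exact: measurable_config iX.1. Qed.

(** The two terms of [sqr_weight_best_change1] have the same mean, since they
    are exchanged with the copies of [e]. In the first one the new weight of
    [e] is independent of the optimal path of the original weights, so that the
    mean is a product. *)
Lemma resample1_le (e : I) :
  (sqdist P X f pred0 (pred1 e) <=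
   (2 * M)%:E * \int[P]_w (e \in best h0 l (X w))%:R%:E)%E.
Proof.
pose F (a : pred I) (b : bool) (y : config (I * bool)%type R) :=
  ((y (e, b)) ^+ 2 *+ (e \in best h0 l (mix a y)))%:E.
have F0 a b y : (0 <= F a b y)%E by rewrite lee_fin mulrn_wge0 // sqr_ge0.
have mF a b : measurable_fun setT (F a b).
  apply/measurable_EFinP.
  rewrite (_ : (fun y => _) = fun y : config (I * bool)%type R =>
     (y (e, b)) ^+ 2 * (e \in best h0 l (mix a y))%:R); last first.
    by apply/funext => y; rewrite -mulr_natr.
  apply: measurable_funM; first by apply: measurable_funX; exact: measurable_coord.
  exact: (measurable_best_comp (fun h => (e \in h)%:R)) (measurable_mix a).
have mFX a b : measurable_fun setT (fun z => F a b (two_copies X z)).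
  exact: measurableT_comp (mF a b) (measurable_two_copies iX).
have FE : (\int[(P \x P)%E]_z F (pred1 e) false (two_copies X z) =
           \int[(P \x P)%E]_z F pred0 true (two_copies X z))%E.
  pose s (p : I * bool) := (p.1, p.2 (+) (p.1 == e)).
  have sK : cancel s s by move=> [i b]; rewrite /s /= addbK.
  rewrite -(@iid_integral_reindex _ _ _ _ _ _ _ s s _ sK (iid_two_copies iX)).
  - apply: eq_integral => z _; set y := two_copies X z.
    rewrite /F /s /= eqxx.
    by have -> : mix (pred1 e) (y \o s) = mix pred0 y;
      [apply/funext => i; rewrite /mix /s /= addbb|].
  - exact: mF.
  - exact: F0.
apply: (@le_trans _ _ (\int[(P \x P)%E]_z (F pred0 true (two_copies X z) +
    F (pred1 e) false (two_copies X z)))%E).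
  apply: ge0_le_integral => //.
  - by move=> z _; rewrite lee_fin sqr_ge0.
  - exact: (measurable_sqdist iX measurable_weight_best).
  - exact: emeasurable_funD.
  - move=> z _; rewrite /F -EFinD lee_fin; set y := two_copies X z.
    have y0 p : 0 <= y p by case: p => i b; rewrite /y /two_copies; case: ifP => _; exact: X0.
    have E1 : mix (pred1 e) y e = y (e, true) by rewrite /mix /= eqxx.
    have := @sqr_weight_best_change1 _ _ (mix pred0 y) (mix (pred1 e) y) e h0 l
      ul (y0 _) (y0 _); rewrite E1; apply=> i /negbTE ie.
    by rewrite /mix /= ie.
rewrite ge0_integralD// FE -mule2n -mule_natl EFinM -muleA.
apply: lee_wpmul2l => //.
rewrite (fubini_tonelli1 (fun z => F pred0 true (two_copies X z)))//.
rewrite -ge0_integralZl //=; last first.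
  apply/measurable_EFinP.
  exact: (measurable_best_comp (fun h => (e \in h)%:R)) measurable_iid.
have mI : measurable_fun setT (fun w => (e \in best h0 l (X w))%:R%:E : \bar R).
  apply/measurable_EFinP.
  exact: (measurable_best_comp (fun h => (e \in h)%:R)) measurable_iid.
apply: ge0_le_integral => //.
- by move=> w _; apply: integral_ge0.
- exact: measurable_fun_fubini_tonelli_F.
- exact: measurable_funeM.
- move=> w _; rewrite /fubini_F /F /= muleC.
  under eq_integral do rewrite -mulr_natl EFinM.
  rewrite [leLHS](_ : _ = \int[P]_w' ((e \in best h0 l (X w))%:R%:E *
    ((X w' e) ^+ 2)%:E))%E //.
  rewrite ge0_integralZl_EFin //; last 2 first.
  + by move=> w' _; rewrite lee_fin sqr_ge0.
  + by apply/measurable_EFinP/measurable_funX; exact: iX.1.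
  by apply: lee_wpmul2l; rewrite ?lee_fin //; exact: XM.
Qed.

(** Summing [resample1_le] over the edges replaces the probabilities that an
    edge is on the optimal path by the mean number of edges of that path. *)
Theorem variance_best_le :
  (\int[(P \x P)%E]_z ((f (X z.1) - f (X z.2)) ^+ 2)%:E <=
   (2 * M)%:E * \int[P]_w (size (best h0 l (X w)))%:R%:E)%E.
Proof.
pose s := undup (flatten (h0 :: l)).
have us : uniq s by exact: undup_uniq.
have hs h e : h \in h0 :: l -> e \in h -> e \in s.
  by move=> hl eh; rewrite mem_undup; apply/flattenP; exists h.
have ws h (x y : I -> R) : h \in h0 :: l -> {in s, x =1 y} -> weight x h = weight y h.
  move=> hl xy; rewrite /weight !big_seq; apply: eq_bigr => e eh.
  exact/xy/(hs h).
apply: le_trans (efron_stein iX measurable_weight_best us _) _.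
  move=> x y xy; apply/eqP; rewrite eq_le /f; apply/andP; split.
    rewrite -(ws _ x y (best_mem h0 l y) xy).
    exact/best_min/best_mem.
  rewrite (ws _ x y (best_mem h0 l x) xy).
  exact/best_min/best_mem.
apply: le_trans (lee_sum _ (fun e _ => resample1_le e)) _.
have mI e : measurable_fun setT (fun w => (e \in best h0 l (X w))%:R%:E : \bar R).
  apply/measurable_EFinP.
  exact: (measurable_best_comp (fun h => (e \in h)%:R)) measurable_iid.
rewrite -ge0_sume_distrr; last by move=> e _; exact: integral_ge0.
apply: lee_wpmul2l; first by rewrite lee_fin mulr_ge0.
rewrite -ge0_integral_sum //.
apply: ge0_le_integral => //.
- by move=> w _; exact: sume_ge0.
- exact: emeasurable_sum.
- apply/measurable_EFinP.
  exact: (measurable_best_comp (fun h => (size h)%:R)) measurable_iid.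
- by move=> w _; rewrite sumEFin lee_fin sum_mem_le_size.
Qed.

End variance.

(** * Walks in the lattice *)

Section walks.
Context (d : nat).
Implicit Types (x y z v : lattice d) (e : edge d) (h : seq (edge d)).

Lemma joinsC e x y : joins e x y = joins e y x.
Proof. by rewrite /joins orbC. Qed.

Lemma joins_inj e x y x' y' : joins e x y -> joins e x' y' ->
  (x' = x /\ y' = y) \/ (x' = y /\ y' = x).
Proof.
by move=> /orP[] /andP[/eqP-> /eqP->] /orP[] /andP[/eqP-> /eqP->]; auto.
Qed.

Lemma connects_cat h1 h2 x y z :
  connects x h1 z -> connects z h2 y -> connects x (h1 ++ h2) y.
Proof.
elim: h1 x => [|e h1 ih] x /=; first by move=> ->.
by move=> [u xu uz] zy; exists u => //; exact: ih.
Qed.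

Lemma connects_split h1 h2 x y : connects x (h1 ++ h2) y ->
  exists2 z, connects x h1 z & connects z h2 y.
Proof.
elim: h1 x => [|e h1 ih] x /=; first by move=> xy; exists x.
by move=> [u xu /ih[z uz zy]]; exists z => //; exists u.
Qed.

Lemma connects_rev h x y : connects x h y -> connects y (rev h) x.
Proof.
elim: h x => [|e h ih] x /=; first by move=> ->.
move=> [z xz zy]; rewrite rev_cons -cats1; apply: connects_cat (ih _ zy) _.
by exists x; rewrite // joinsC.
Qed.

(** Loop removal, from the end of the walk. Suppose that the first edge [e],
    crossed from [x] to [z], is used again by the simplified rest of the walk.
    Either it is crossed there in the same direction, and the walk may start
    at this second crossing, or in the opposite direction, and then the rest
    of the walk passes through [x] just after it. *)
Lemma connects_uniq h x y : connects x h y ->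
  exists h', [/\ uniq h', {subset h' <= h} & connects x h' y].
Proof.
elim: h x => [|e h ih] x /=; first by move=> <-; exists [::].
move=> [z xz /ih[h' [uh' sub zy]]].
have sub' h'' : {subset h'' <= h'} -> {subset e :: h'' <= e :: h}.
  move=> s u; rewrite !inE => /orP[-> //|/s /sub ->]; exact: orbT.
have [eh'|eh'] := boolP (e \in h'); last first.
  by exists (e :: h'); split; [rewrite /= eh'|exact: sub'|exists z].
case/splitPr: eh' uh' zy sub sub' => h1 h2.
rewrite cat_uniq => /and3P[_ _ ueh2] /connects_split[u _ /= [v uv vy]] _ sub'.
have [[ux _]|[_ vx]] := joins_inj xz uv.
  exists (e :: h2); split => //; last by exists v; rewrite -?ux.
  by apply: sub' => w wh; rewrite mem_cat inE wh !orbT.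
exists h2; split; [by case/andP: ueh2| |by rewrite -vx].
move=> w wh; apply: (sub' h2); last by rewrite inE wh orbT.
by move=> w' wh'; rewrite mem_cat inE wh' !orbT.
Qed.

Definition shift_edge v e : edge d := (e.1 + v, e.2).

Lemma shift_edgeK v : cancel (shift_edge v) (shift_edge (- v)).
Proof. by move=> [x i]; rewrite /shift_edge /= addrK. Qed.

Lemma connects_shift v h x y :
  connects x h y -> connects (x + v) (map (shift_edge v) h) (y + v).
Proof.
elim: h x => [|e h ih] x /=; first by move=> ->.
move=> [z xz /ih zy]; exists (z + v) => //.
move: xz; rewrite /joins /= => /orP[] /andP[/eqP-> /eqP->].
  by rewrite addrAC !eqxx.
by rewrite [_ + v + _]addrAC !eqxx orbT.
Qed.

Lemma is_path_shift v h x y :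
  is_path x y h -> is_path (x + v) (y + v) (map (shift_edge v) h).
Proof.
move=> [uh xy]; split; last exact: connects_shift.
by rewrite map_inj_uniq //; exact: can_inj (shift_edgeK v).
Qed.

(** An edge changes each coordinate by at most one. *)
Lemma connects_coord i h x y : connects x h y ->
  (`|y 0%R i - x 0%R i| <= size h)%N.
Proof.
elim: h x => [|e h ih] x /=; first by move=> ->; rewrite subrr.
move=> [z xz /ih zy].
have xz1 : (`|z 0%R i - x 0%R i| <= 1)%N.
  move: xz; rewrite /joins => /orP[] /andP[/eqP-> /eqP->]; rewrite !mxE eqxx /=.
    by rewrite addrAC subrr add0r; case: (i == _).
  by rewrite opprD addrA subrr add0r abszN; case: (i == _).
move: zy xz1; move: (y 0 i) (z 0 i) (x 0 i) => a b c.
lia.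
Qed.

(** A superset, easy to count, of the paths with [m] edges that start at [x];
    repeated edges are allowed. *)
Fixpoint walks x m : seq (seq (edge d)) :=
  if m is m'.+1 then
    flatten [seq map (cons (x, i)) (walks (x + delta_mx 0 i) m') ++
                 map (cons (x - delta_mx 0 i, i)) (walks (x - delta_mx 0 i) m')
            | i <- enum 'I_d]
  else [:: [::]].

Lemma size_walks x m : size (walks x m) = ((2 * d) ^ m)%N.
Proof.
elim: m x => [|m ih] x //=; rewrite size_flatten /shape -map_comp sumnE big_map.
rewrite (eq_bigr (fun=> 2 * (2 * d) ^ m)%N); last first.
  by move=> i _ /=; rewrite size_cat !size_map !ih addnn -mul2n.
by rewrite big_const_seq count_predT size_enum_ord iter_addn_0 expnS mulnAC.
Qed.

Lemma mem_walks h x y : connects x h y -> h \in walks x (size h).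
Proof.
elim: h x => [|e h ih] x //= [z xz /ih zh].
apply/flattenP; case: e xz => u i; rewrite /joins /= => xz.
exists (map (cons (x, i)) (walks (x + delta_mx 0 i) (size h)) ++
        map (cons (x - delta_mx 0 i, i)) (walks (x - delta_mx 0 i) (size h))).
  by apply/mapP; exists i; rewrite ?mem_enum.
rewrite mem_cat; case/orP: xz => /andP[/eqP E1 /eqP E2].
  by rewrite E1 -E2 map_f.
by rewrite E2 addrK -E1 map_f ?orbT.
Qed.

Lemma size_mem_walks m x h : h \in walks x m -> size h = m.
Proof.
elim: m x h => [|m ih] x h /=; first by rewrite inE => /eqP ->.
case/flattenP => _ /mapP[i _ ->]; rewrite mem_cat.
by case/orP => /mapP[h' /ih <- ->].
Qed.

End walks.

(** * First-passage times *)

Section first_passage.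
Context (R : realType) (d : nat).
Implicit Types (x y z v : lattice d) (e : edge d) (h : seq (edge d)).
Implicit Types tau : config (edge d) R.

Definition fpt tau x y : R := inf [set weight tau h | h in is_path x y].

Lemma weight_ge0 tau h : (forall e, 0 <= tau e) -> 0 <= weight tau h.
Proof. by move=> tau0; exact: sumr_ge0. Qed.

Lemma weight_cat tau h1 h2 :
  weight tau (h1 ++ h2) = weight tau h1 + weight tau h2.
Proof. exact: big_cat. Qed.

Lemma weight_sub tau h h' : (forall e, 0 <= tau e) -> uniq h' ->
  {subset h' <= h} -> weight tau h' <= weight tau h.
Proof.
move=> tau0; elim: h h' => [|e h ih] h' uh' sub.
  by case: h' uh' sub => [//|e h' _ /(_ e)]; rewrite mem_head => /(_ isT).
rewrite /weight big_cons -!/(weight _ _).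
have sub' : {subset [seq u <- h' | u != e] <= h}.
  move=> u; rewrite mem_filter => /andP[ue /sub].
  by rewrite inE (negbTE ue).
have := ih _ (filter_uniq _ uh') sub'; rewrite /weight big_filter => ih'.
have [eh'|eh'] := boolP (e \in h').
  by rewrite (bigD1_seq e) //= lerD2l.
apply: le_trans (ler_wpDl (tau0 e) ih').
rewrite [X in X <= _]big_seq [X in _ <= X]big_seq_cond.
rewrite le_eqVlt; apply/orP; left; apply/eqP/eq_bigl => u.
by case: (boolP (u \in h')) => //= uh; apply/esym; apply: contraNneq eh' => <-.
Qed.

Lemma has_inf_fpt tau x y h : (forall e, 0 <= tau e) -> connects x h y ->
  has_inf [set weight tau h' | h' in is_path x y].
Proof.
move=> tau0 /connects_uniq[h' [uh' _ xy]]; split.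
  by exists (weight tau h'), h'.
by exists 0 => _ [k _ <-]; exact: weight_ge0.
Qed.

Lemma fpt_ge0 tau x y : (forall e, 0 <= tau e) -> 0 <= fpt tau x y.
Proof.
move=> tau0; rewrite /fpt.
have [->|ne] := eqVneq [set weight tau h | h in is_path x y] set0.
  by rewrite inf0.
by apply: lb_le_inf; [exact/set0P|move=> _ [k _ <-]; exact: weight_ge0].
Qed.

Lemma fpt_le tau x y h : (forall e, 0 <= tau e) -> connects x h y ->
  fpt tau x y <= weight tau h.
Proof.
move=> tau0 xy; have [h' [uh' sub xy']] := connects_uniq xy.
apply: le_trans (weight_sub tau0 uh' sub).
apply: ge_inf; first by case: (has_inf_fpt tau0 xy).
by exists h'.
Qed.

Lemma fpt_adherent tau x y h (delta : R) : (forall e, 0 <= tau e) ->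
  connects x h y -> 0 < delta ->
  exists2 h', is_path x y h' & weight tau h' < fpt tau x y + delta.
Proof.
move=> tau0 xy d0; have := inf_adherent d0 (has_inf_fpt tau0 xy).
by move=> [_ [h' ph' <-] lt]; exists h'.
Qed.

Lemma fpt_triangle tau x y z h1 h2 : (forall e, 0 <= tau e) ->
  connects x h1 y -> connects y h2 z ->
  fpt tau x z <= fpt tau x y + fpt tau y z.
Proof.
move=> tau0 xy yz; apply/ler_addgt0Pr => delta d0.
have d20 : 0 < delta / 2 by rewrite divr_gt0.
have [k1 [_ pk1] lt1] := fpt_adherent tau0 xy d20.
have [k2 [_ pk2] lt2] := fpt_adherent tau0 yz d20.
have := fpt_le tau0 (connects_cat pk1 pk2); rewrite weight_cat; lra.
Qed.

Lemma fpt_shift tau v x y :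
  fpt (fun e => tau (shift_edge v e)) x y = fpt tau (x + v) (y + v).
Proof.
congr inf; apply/seteqP; split => _ [h ph <-].
  exists (map (shift_edge v) h); first exact: is_path_shift.
  by rewrite /weight big_map.
exists (map (shift_edge (- v)) h).
  by have := is_path_shift (- v) ph; rewrite !addrK.
rewrite /weight big_map; apply: eq_bigr => -[u i] _.
by rewrite /shift_edge /= subrK.
Qed.

(** An exhaustion by finite lists of the countable set of paths from [x] to
    [y]. *)
Definition paths_upto x y N : seq (seq (edge d)) :=
  [seq h <- pmap unpickle (iota 0 N) | `[< is_path x y h >]].

Lemma mem_paths_upto x y N h :
  h \in paths_upto x y N -> is_path x y h.
Proof. by rewrite mem_filter => /andP[/asboolP]. Qed.

Lemma paths_upto_complete x y N h : is_path x y h -> (pickle h < N)%N ->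
  h \in paths_upto x y N.
Proof.
move=> ph hN; rewrite mem_filter; apply/andP; split; first exact/asboolP.
rewrite mem_pmap; apply/mapP; exists (pickle h); first by rewrite mem_iota.
by rewrite pickleK.
Qed.

Definition fpt_approx h0 x y N tau :=
  weight tau (best h0 (paths_upto x y N) tau).

Lemma fpt_le_approx tau h0 x y N : (forall e, 0 <= tau e) -> is_path x y h0 ->
  fpt tau x y <= fpt_approx h0 x y N tau.
Proof.
move=> tau0 p0; apply: fpt_le => //.
have := best_mem h0 (paths_upto x y N) tau.
by rewrite inE => /orP[/eqP ->|/mem_paths_upto[]] //; case: p0.
Qed.

(** A nearly optimal path belongs to all but finitely many of the lists. *)
Lemma cvg_fpt_approx tau h0 x y : (forall e, 0 <= tau e) -> is_path x y h0 ->
  fpt_approx h0 x y N tau @[N --> \oo] --> fpt tau x y.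
Proof.
move=> tau0 p0; apply/cvgrPdist_le => delta d0.
have [h ph lt] := fpt_adherent tau0 (proj2 p0) d0.
exists (pickle h).+1 => // N /= hN.
have le1 := fpt_le_approx N tau0 p0.
have le2 : fpt_approx h0 x y N tau <= weight tau h.
  by apply: best_min; rewrite inE (paths_upto_complete ph) ?orbT.
rewrite distrC ger0_norm; lra.
Qed.

Lemma measurable_fpt_approx h0 x y N :
  measurable_fun setT (fpt_approx h0 x y N).
Proof. exact: (measurable_best _ _ (@measurable_weight (edge d) R)). Qed.

End first_passage.

(** * The first coordinate axis *)

Section axis.
Context (R : realType) (d : nat).
Hypothesis d_gt0 : (0 < d)%N.
Implicit Types tau : config (edge d) R.

Definition axis_edge (j : nat) : edge d := (axis_point d j, Ordinal d_gt0).

Definition axis_line (m k : nat) : seq (edge d) :=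
  [seq axis_edge j | j <- iota m k].

Lemma axis_pointD m n : axis_point d m + axis_point d n = axis_point d (m + n).
Proof. by apply/rowP => i; rewrite !mxE; case: ifP; rewrite ?addr0 ?PoszD. Qed.

Lemma axis_pointS m :
  axis_point d m.+1 = axis_point d m + delta_mx 0 (Ordinal d_gt0).
Proof.
apply/rowP => i; rewrite !mxE eqxx /= -val_eqE /=.
by case: eqP => _; rewrite ?addr0 // -addn1 PoszD.
Qed.

Lemma connects_axis_line m k :
  connects (axis_point d m) (axis_line m k) (axis_point d (m + k)).
Proof.
elim: k m => [|k ih] m /=; first by rewrite addn0.
exists (axis_point d m.+1); last by rewrite addnS -addSn; exact: ih.
by rewrite /joins /= axis_pointS !eqxx.
Qed.

Lemma axis_point_coord m : axis_point d m 0 (Ordinal d_gt0) = m.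
Proof. by rewrite mxE. Qed.

Lemma is_path_axis_line n :
  is_path (axis_point d 0) (axis_point d n) (axis_line 0 n).
Proof.
split; last exact: connects_axis_line.
rewrite map_inj_uniq ?iota_uniq // => i j [/rowP/(_ (Ordinal d_gt0))].
by rewrite !axis_point_coord => -[].
Qed.

Lemma size_axis_path n h :
  connects (axis_point d 0) h (axis_point d n) -> (n <= size h)%N.
Proof.
by move=> /(connects_coord (Ordinal d_gt0)); rewrite !axis_point_coord subr0.
Qed.

Definition axis_time tau n := fpt tau (axis_point d 0) (axis_point d n).

Lemma axis_time_ge0 tau n : (forall e, 0 <= tau e) -> 0 <= axis_time tau n.
Proof. exact: fpt_ge0. Qed.

Lemma axis_time_le_line tau n : (forall e, 0 <= tau e) ->
  axis_time tau n <= weight tau (axis_line 0 n).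
Proof. by move=> tau0; exact: fpt_le tau0 (connects_axis_line 0 n). Qed.

(** The passage time from (m, 0) to (m + n, 0) is the passage time to (n, 0)
    for the translated weights. *)
Lemma axis_time_subadditive tau m n : (forall e, 0 <= tau e) ->
  axis_time tau (m + n) <= axis_time tau m +
    axis_time (fun e => tau (shift_edge (axis_point d m) e)) n.
Proof.
move=> tau0; rewrite /axis_time fpt_shift !axis_pointD add0n addnC.
apply: fpt_triangle => //; first exact: connects_axis_line.
by rewrite [(n + m)%N]addnC; exact: connects_axis_line.
Qed.

(** The straight segment can be appended to a path, in both directions. *)
Lemma axis_time_dist tau m k : (forall e, 0 <= tau e) ->
  `|axis_time tau (m + k) - axis_time tau m| <= weight tau (axis_line m k).
Proof.
move=> tau0; have c0 := connects_axis_line 0 m.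
have cmk := connects_axis_line m k.
have h1 := fpt_triangle tau0 c0 cmk.
have h2 := fpt_triangle tau0 (connects_axis_line 0 (m + k)) (connects_rev cmk).
have h3 := fpt_le tau0 cmk.
have := fpt_le tau0 (connects_rev cmk).
rewrite {1}/weight (perm_big _ (permEl (perm_rev _))) /= -/(weight _ _) => h4.
by rewrite ler_norml; apply/andP; move: h1 h2; rewrite /axis_time; split; lra.
Qed.

End axis.

(** * The Peierls estimate *)

Lemma union_bound d (T : measurableType d) (R : realType)
    (mu : {measure set T -> \bar R}) (I : Type) (s : seq I) (F : I -> set T) :
  (forall i, measurable (F i)) ->
  (mu (\big[setU/set0]_(i <- s) F i) <= \sum_(i <- s) mu (F i))%E.
Proof.
move=> mF; elim: s => [|i s ih]; first by rewrite !big_nil measure0.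
rewrite !big_cons (le_trans (measureU2 _ _ _)) //; last by rewrite leeD2l.
by apply: bigsetU_measurable => j _.
Qed.

Lemma prode_le_expr (R : realType) (I : Type) (s : seq I) (c : \bar R) (a : R) :
  (0 <= c)%E -> (c <= a%:E)%E -> (\prod_(i <- s) c <= (a ^+ size s)%:E)%E.
Proof.
move=> c0 ca; elim: s => [|i s ih]; first by rewrite big_nil expr0.
rewrite big_cons exprS EFinM; apply: lee_pmul => //.
by elim/big_ind : _ => // x y; exact: mule_ge0.
Qed.

Section peierls.
Context (d : nat) (R : realType) disp (T : measurableType disp).
Variables (P : probability T R) (nu : set R -> \bar R).
Variable X : T -> config (edge d) R.
Hypothesis iX : iid P nu X.
Hypothesis X0 : forall w e, 0 <= X w e.
Variables (q eps : R).
Hypotheses (q0 : 0 <= q) (q1 : q <= 1) (eps0 : 0 < eps).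
Hypothesis nu_ge0 : (0 <= nu [set r | r < eps]%R)%E.
Hypothesis small : (nu [set r | r < eps]%R <= (q ^+ 2)%:E)%E.

Lemma measurable_lt_cst : measurable [set r : R | r < eps].
Proof.
by rewrite (_ : [set r | _] = `]-oo, eps[%classic).
Qed.

Definition light (m : nat) (h : seq (edge d)) (w : T) : bool :=
  weight (X w) h < eps * m%:R / 2.

Lemma measurable_light m h : measurable [set w | light m h w].
Proof.
rewrite (_ : [set w | _] = setT `&` (fun w => weight (X w) h) @^-1`
    `]-oo, (eps * m%:R / 2)[%classic); last first.
  by rewrite setTI; apply/seteqP; split=> w /=; rewrite in_itv.
have mw : measurable_fun setT (fun w => weight (X w) h).
  by apply: measurable_sum => e; exact: iX.1.
exact: mw.
Qed.

(** Otherwise more than half of the edges would weigh at least [eps] each. *)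
Lemma light_half_small (w : T) h : light (size h) h w ->
  (size h <= 2 * size [seq e <- h | (X w e < eps)%R])%N.
Proof.
move=> hl; have : eps * (size [seq e <- h | ~~ (X w e < eps)])%:R <=
    weight (X w) h.
  rewrite /weight (bigID (fun e => X w e < eps)) /= -[leLHS]add0r.
  apply: lerD; first exact: sumr_ge0.
  rewrite size_filter -sum1_count natr_sum mulr_sumr.
  by apply: ler_sum => e; rewrite mulr1 leNgt.
move=> /le_lt_trans /(_ hl); rewrite -mulrA ltr_pM2l //.
rewrite ltr_pdivlMr // -natrM ltr_nat.
have <- : (count (fun e => (X w e < eps)%R) h +
  count (fun e => ~~ (X w e < eps)%R) h = size h)%N by rewrite count_predC.
by rewrite !size_filter; lia.
Qed.

(** A union bound over the sets of at least half of the edges of [h], of which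
    there are at most 2^m: by
    independence all edges of such a set are below [eps] with probability at
    most (q^2)^(m / 2). *)
Lemma light_prob h : uniq h ->
  (P [set w | light (size h) h w] <= ((2 * q) ^+ size h)%:E)%E.
Proof.
move=> uh; set m := size h.
pose C (b : m.-tuple bool) :=
  \bigcap_(e in [set` mask b h]) (X ^~ e) @^-1` [set r | r < eps]%R.
have mC b : measurable (C b).
  apply: bigcap_seq_measurable => e; rewrite -[X in measurable X]setTI.
  exact: (iX.1 e measurableT _ measurable_lt_cst).
pose s := [seq b : m.-tuple bool <- enum {: m.-tuple bool} | (m <= 2 * size (mask b h))%N].
apply: (@le_trans _ _ (P (\big[setU/set0]_(b <- s) C b))).
  rewrite le_measure ?inE //; first exact: measurable_light.
    by apply: bigsetU_measurable => b _.
  move=> w hl; rewrite -bigcup_seq.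
  have bP : size (map (fun e => X w e < eps) h) == m by rewrite size_map.
  exists (Tuple bP).
    rewrite /= mem_filter mem_enum andbT -filter_mask.
    exact: light_half_small.
  by move=> e; rewrite /= -filter_mask mem_filter => /andP[].
apply: le_trans (union_bound _ _ mC) _.
apply: (@le_trans _ _ (\sum_(b <- s) (q ^+ m)%:E)%E).
  rewrite big_seq [leRHS]big_seq; apply: lee_sum => b.
  rewrite mem_filter => /andP[mb _].
  rewrite [leLHS](_ : _ = \prod_(e <- mask b h) nu [set r | r < eps]%R)%E; last first.
    apply: (iX.2 _ (fun=> [set r | r < eps]%R)) => [|_].
      exact: mask_uniq.
    exact: measurable_lt_cst.
  apply: le_trans (prode_le_expr _ nu_ge0 small) _.
  by rewrite lee_fin -exprM ler_wiXn2l.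
rewrite sumEFin lee_fin big_const_seq iter_addr_0 exprMn -[leLHS]mulr_natl.
rewrite ler_wpM2r ?exprn_ge0 //.
rewrite -natrX ler_nat count_predT size_filter.
by rewrite (leq_trans (count_size _ _)) // -cardE card_tuple card_bool.
Qed.

Variable x0 : lattice d.

Definition light_size (m : nat) (w : T) : R :=
  \sum_(h <- [seq h <- walks x0 m | uniq h]) m%:R * (light m h w)%:R.

(** The total number of edges, counted path by path, of the light paths from
    [x0]; a path with too small a weight contributes its own size. *)
Definition light_excess (w : T) : \bar R :=
  (\sum_(m <oo) (light_size m w)%:E)%E.

Lemma light_size_ge0 m w : 0 <= light_size m w.
Proof. by apply: sumr_ge0 => h _; rewrite mulr_ge0. Qed.

Lemma measurable_light_indic m h :
  measurable_fun setT (fun w => (light m h w)%:R : R).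
Proof.
rewrite (_ : (fun w => _) = \1_[set w | light m h w]); last first.
  by apply/funext => w; rewrite indicE mem_setE.
exact/measurable_indic/measurable_light.
Qed.

Lemma measurable_light_size m : measurable_fun setT (light_size m).
Proof.
by apply: measurable_sum => h; apply: measurable_funM => //;
  exact: measurable_light_indic.
Qed.

Lemma measurable_light_excess : measurable_fun setT light_excess.
Proof.
apply: ge0_emeasurable_sum => [m w _ _|m _].
  by rewrite lee_fin light_size_ge0.
exact/measurable_EFinP/measurable_light_size.
Qed.

Lemma light_excess_ge0 w : (0 <= light_excess w)%E.
Proof. by apply: nneseries_ge0 => m _ _; rewrite lee_fin light_size_ge0. Qed.

(** Either [h] is not light, and the first term suffices, or it is one of the
    paths counted by the second. *)
Lemma path_size_le w y h : is_path x0 y h ->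
  ((size h)%:R%:E <= (2 / eps * weight (X w) h)%:E + light_excess w)%E.
Proof.
move=> [uh xy]; set m := size h.
have w0 : 0 <= weight (X w) h by apply: weight_ge0; exact: X0.
have [hl|hl] := boolP (light m h w); last first.
  rewrite -[leLHS]adde0; apply: leeD; last exact: light_excess_ge0.
  rewrite lee_fin; move: hl; rewrite -leNgt => hl.
  rewrite -(ler_pM2l eps0); apply: le_trans (_ : 2 * weight (X w) h <= _).
    by rewrite -ler_pdivrMl // mulrC.
  by rewrite mulrA mulrCA divff ?mulr1 // gt_eqF.
rewrite -[leLHS]add0e; apply: leeD.
  by rewrite lee_fin mulr_ge0 // divr_ge0 // ltW.
apply: (@le_trans _ _ (light_size m w)%:E).
  rewrite lee_fin /light_size (big_rem h) /=; last first.
    by rewrite mem_filter uh /=; exact: mem_walks xy.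
  rewrite hl mulr1 lerDl; apply: sumr_ge0 => k _; exact: mulr_ge0.
apply: le_trans (nneseries_lim_ge m.+1 _) => //.
  rewrite big_nat_recr //= leeDr //.
  by apply: sume_ge0 => k _; rewrite lee_fin light_size_ge0.
by move=> k _ _; rewrite lee_fin light_size_ge0.
Qed.

Hypothesis dq : (2 * d)%:R * (2 * q) <= 1 / 4.

(** There are (2 d)^m walks, each light with probability at most (2 q)^m, and
    [dq] bounds the product by 4^-m; one factor 2^m absorbs [m]. *)
Lemma integral_light_size_le m :
  (\int[P]_w (light_size m w)%:E <= ((1 / 2) ^+ m)%:E)%E.
Proof.
under eq_integral do rewrite /light_size -sumEFin.
rewrite ge0_integral_sum //; last first.
  move=> h; apply/measurable_EFinP/measurable_funM => //.
  exact: measurable_light_indic.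
apply: (@le_trans _ _ (\sum_(h <- [seq h <- walks x0 m | uniq h])
    (m%:R * (2 * q) ^+ m)%:E)%E).
  rewrite big_seq [leRHS]big_seq; apply: lee_sum => h.
  rewrite mem_filter => /andP[uh hm].
  under eq_integral do rewrite EFinM.
  rewrite ge0_integralZl_EFin //; last first.
    by apply/measurable_EFinP; exact: measurable_light_indic.
  rewrite EFinM; apply: lee_wpmul2l => //.
  rewrite -(size_mem_walks hm); apply: le_trans (light_prob uh).
  rewrite (eq_integral (fun w => (\1_[set w | light (size h) h w] w)%:E)).
    by rewrite integral_indic ?setIT //; exact: measurable_light.
  by move=> w _; rewrite indicE mem_setE.
rewrite sumEFin lee_fin big_const_seq iter_addr_0 count_predT.
apply: (@le_trans _ _ ((m%:R * (2 * q) ^+ m) *+ ((2 * d) ^ m))).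
  rewrite ler_wpMn2l //; last first.
    by rewrite size_filter (leq_trans (count_size _ _)) // size_walks.
  by rewrite mulr_ge0 // exprn_ge0 // mulr_ge0.
rewrite -mulr_natl natrX mulrCA -exprMn.
apply: (@le_trans _ _ (2 ^+ m * (1 / 4) ^+ m)).
  apply: ler_pM => //.
  - by rewrite exprn_ge0 // !mulr_ge0.
  - by rewrite -natrX ler_nat ltnW // ltn_expl.
  - by rewrite lerXn2r ?nnegrE // !mulr_ge0.
by rewrite -exprMn lerXn2r ?nnegrE //; lra.
Qed.

Lemma integral_light_excess_le : (\int[P]_w light_excess w <= 2%:E)%E.
Proof.
rewrite integral_nneseries //; last 2 first.
- by move=> m; apply/measurable_EFinP; exact: measurable_light_size.
- by move=> m w _; rewrite lee_fin light_size_ge0.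
apply: lime_le.
  apply: is_cvg_nneseries => m _ _; apply: integral_ge0 => w _.
  by rewrite lee_fin light_size_ge0.
apply: nearW => n; apply: le_trans (lee_sum _ (fun m _ => integral_light_size_le m)) _.
rewrite sumEFin lee_fin.
suff -> : \sum_(0 <= m < n) (1 / 2) ^+ m = 2 - 2 * (1 / 2) ^+ n :> R.
  by rewrite gerBl mulr_ge0 // exprn_ge0.
elim: n => [|n ih]; first by rewrite big_geq // expr0; lra.
by rewrite big_nat_recr //= ih exprS; lra.
Qed.

End peierls.

(** * Convergence of sequences and of square-integrable variables *)

Lemma sqr_sum_le (R : realDomainType) (I : Type) (s : seq I) (a : I -> R) :
  (\sum_(i <- s) a i) ^+ 2 <= (size s)%:R * \sum_(i <- s) a i ^+ 2.
Proof.
have cross b r : 2 * b * \sum_(i <- r) a i <=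
    (size r)%:R * b ^+ 2 + \sum_(i <- r) a i ^+ 2.
  elim: r => [|i r ih]; first by rewrite !big_nil /= mulr0 mul0r addr0.
  rewrite !big_cons /= -natr1; have := sqr_ge0 (b - a i).
  by move: ih; set S := \sum_(j <- r) _; set Q := \sum_(j <- r) _; nra.
elim: s => [|i s ih]; first by rewrite !big_nil /= expr0n mul0r.
rewrite !big_cons /= -natr1; move: ih (cross (a i) s).
by set S := \sum_(j <- s) _; set Q := \sum_(j <- s) _; nra.
Qed.

(** The limit is the infimum of [u n / n]: once [u m / m] is close to it,
    dividing [n] by [m] with remainder [r] gives
    u n <= (n / m) u m + u r, and the last term is bounded. *)
Lemma fekete (R : realType) (u : nat -> R) : (forall n, 0 <= u n) ->
  (forall m n, u (m + n)%N <= u m + u n) ->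
  cvgn (fun n => u n / n%:R).
Proof.
move=> u0 uD; pose S := [set u n.+1 / n.+1%:R | n in [set: nat]].
have S0 r : S r -> 0 <= r by move=> [n _ <-]; rewrite divr_ge0.
have hS : has_inf S by split; [exists (u 1%N / 1%:R), 0%N|exists 0].
apply/cvg_ex; exists (inf S); apply/cvgrPdist_le => delta d0.
have d20 : 0 < delta / 2 by rewrite divr_gt0.
have [_ [m _ <-] ltm] := inf_adherent d20 hS.
have u_mul k r : u (k * m.+1 + r)%N <= k%:R * u m.+1 + u r.
  elim: k => [|k ih]; first by rewrite mul0n add0n mul0r add0r.
  rewrite mulSn -addnA; apply: le_trans (uD _ _) _.
  by rewrite -natr1 mulrDl mul1r; lra.
pose C := \sum_(r < m.+1) u r.
have uC r : (r < m.+1)%N -> u r <= C.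
  move=> rm; rewrite /C (bigD1 (Ordinal rm)) //= lerDl.
  by apply: sumr_ge0 => i _.
have C0 : 0 <= C by apply: sumr_ge0 => i _.
exists (Num.truncn (C / (delta / 2))).+1 => // n /= hn.
have n0 : (0 < n)%N by apply: leq_trans hn.
have n0R : 0 < n%:R :> R by rewrite ltr0n.
have Cn : C / n%:R <= delta / 2.
  rewrite ler_pdivrMr // mulrC -ler_pdivrMr //.
  apply/ltW/(lt_le_trans (truncnS_gt _)).
  by rewrite ler_nat.
have infn : inf S <= u n / n%:R.
  apply: ge_inf; first by case: hS.
  by exists n.-1 => //; rewrite prednK.
have un : u n / n%:R <= u m.+1 / m.+1%:R + C / n%:R.
  rewrite {1}(divn_eq n m.+1) ler_pdivrMr // mulrDl.
  apply: le_trans (u_mul _ _) _; rewrite divfK ?gt_eqF //.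
  apply: lerD; last by apply: uC; rewrite ltn_mod.
  rewrite mulrC -mulrA ler_wpM2l // mulrC ler_pdivlMr ?ltr0n //.
  by rewrite -natrM ler_nat leq_trunc_div.
rewrite distrC; move: ltm infn un Cn.
move: (u n / _) (u m.+1 / _) (C / _) (inf S) => x y z l.
by move=> ? ? ? ?; rewrite ger0_norm; lra.
Qed.

(** Integrate the tangent inequality
    (a - y)^2 >= (a - g)^2 + 2 (a - g) (g - y). *)
Lemma jensen_sqr d (T : measurableType d) (R : realType)
    (P : probability T R) (Y : T -> R) (a g : R) :
  P.-integrable setT (EFin \o Y) -> (\int[P]_w (Y w)%:E = g%:E)%E ->
  (((a - g) ^+ 2)%:E <= \int[P]_w ((a - Y w) ^+ 2)%:E)%E.
Proof.
move=> iY Yg; have mY : measurable_fun setT Y.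
  by apply/measurable_EFinP; case/integrableP: iY.
have mS : measurable_fun setT (fun w => ((a - Y w) ^+ 2)%:E).
  by apply/measurable_EFinP/measurable_funX/measurable_funB.
have [->|Soo] := eqVneq (\int[P]_w ((a - Y w) ^+ 2)%:E)%E +oo%E.
  exact: leey.
pose c1 := (a - g) ^+ 2 + 2 * (a - g) * g; pose c2 := - (2 * (a - g)).
have iZ : P.-integrable setT (fun w => c2%:E * (Y w)%:E)%E.
  exact: integrableZl.
have i1 : P.-integrable setT (cst c1%:E) by exact: finite_measure_integrable_cst.
rewrite [leLHS](_ : _ = \int[P]_w (c1%:E + c2%:E * (Y w)%:E))%E; last first.
  rewrite integralD //= integralZl //= Yg integral_cst //= probability_setT mule1.
  by rewrite -EFinM -EFinD /c1 /c2; congr EFin; ring.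
apply: le_integral => //.
- exact: integrableD.
- apply/integrableP; split=> //.
  under eq_integral do rewrite gee0_abs ?lee_fin ?sqr_ge0 //.
  by rewrite ltey.
- move=> w _; rewrite -EFinM -EFinD lee_fin /c1 /c2.
  by have := sqr_ge0 (Y w - g); nra.
Qed.

Lemma cvg0_nneseries (R : realType) (u : nat -> R) : (forall k, 0 <= u k) ->
  (\sum_(k <oo) (u k)%:E < +oo)%E -> u k @[k --> \oo] --> 0.
Proof.
move=> u0 fin; apply: cvg_series_cvg_0; apply: nondecreasing_is_cvgn.
  by apply/nondecreasing_seqP => n; rewrite seriesEnat /= big_nat_recr //= lerDl.
have S0 : (0 <= \sum_(k <oo) (u k)%:E)%E.
  by apply: nneseries_ge0 => k _ _; rewrite lee_fin.
exists (fine (\sum_(k <oo) (u k)%:E)%E) => _ [n _ <-].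
rewrite -lee_fin fineK ?ge0_fin_numE // seriesEnat /= -sumEFin.
by apply: nneseries_lim_ge => k _ _; rewrite lee_fin.
Qed.

(** The sum of the variables has a finite mean, so it is almost surely a
    convergent series, whose terms tend to zero. *)
Lemma ae_cvg0_summable d (T : measurableType d) (R : realType)
    (P : probability T R) (Y : nat -> T -> R) (c : nat -> R) (C : R) :
  (forall k, measurable_fun setT (Y k)) -> (forall k w, 0 <= Y k w) ->
  (forall k, (\int[P]_w (Y k w)%:E <= (c k)%:E)%E) ->
  (forall n, \sum_(0 <= k < n) c k <= C) ->
  {ae P, forall w, Y k w @[k --> \oo] --> 0}.
Proof.
move=> mY Y0 Yc cC; pose S w := (\sum_(k <oo) (Y k w)%:E)%E.
have S0 w : (0 <= S w)%E by apply: nneseries_ge0 => k _ _; rewrite lee_fin.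
have mS : measurable_fun setT S.
  apply: ge0_emeasurable_sum => [k w _ _|k _]; first by rewrite lee_fin.
  exact/measurable_EFinP.
have iS : P.-integrable setT S.
  apply/integrableP; split=> //.
  under eq_integral do rewrite gee0_abs //.
  rewrite integral_nneseries //; last 2 first.
  - by move=> k; exact/measurable_EFinP.
  - by move=> k w _; rewrite lee_fin.
  apply: (@le_lt_trans _ _ C%:E); last exact: ltry.
  apply: lime_le.
    by apply: is_cvg_nneseries => k _ _; apply: integral_ge0 => w _; rewrite lee_fin.
  apply: nearW => n; apply: le_trans (lee_sum _ (fun k _ => Yc k)) _.
  by rewrite sumEFin lee_fin.
have := integrable_ae measurableT iS.
apply: filterS => w /(_ I) Sfin; apply: cvg0_nneseries => //.
by rewrite -/(S w) -ge0_fin_numE.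
Qed.

Lemma nat_sqrt_ex (n : nat) : exists k, (k * k <= n <= k * k + 2 * k)%N.
Proof.
elim: n => [|n [k kn]]; first by exists 0%N.
have [h|h] := leqP n.+1 (k * k + 2 * k); first by exists k; lia.
by exists k.+1; nia.
Qed.

Lemma sum_inv_sqr_le (R : realFieldType) (n : nat) :
  \sum_(0 <= k < n) ((k * k)%:R^-1 : R) <= 2.
Proof.
case: n => [|[|n]]; first by rewrite big_geq.
  by rewrite big_nat1 mul0n invr0.
apply: (@le_trans _ _ (2 - n.+1%:R^-1)); last by rewrite gerBl invr_ge0.
elim: n => [|n ih].
  by rewrite big_nat_recr //= big_nat1 mul0n mul1n invr0 invr1; lra.
rewrite big_nat_recr //=; apply: le_trans (lerD ih (lexx _)) _.
rewrite -addrA lerD2l natrM invfM.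
set a : R := n.+1%:R; set b : R := n.+2%:R.
have a0 : 0 < a by rewrite ltr0n.
have b0 : 0 < b by rewrite ltr0n.
have ba : b = a + 1 by rewrite /b /a -natr1.
have -> : - a^-1 + b^-1 * b^-1 = - b^-1 - a^-1 * b^-1 * b^-1.
  by rewrite ba; field; rewrite ba in b0; lra.
by rewrite gerBl !mulr_ge0 // invr_ge0 ltW.
Qed.

Lemma cvg_div_nat (R : realType) (c : R) : c / k%:R @[k --> \oo] --> 0.
Proof.
rewrite -cvg_shiftS /=.
have := cvgM (cvg_cst c) (@cvg_harmonic R); rewrite mulr0; exact.
Qed.

(** With k^2 <= n <= k^2 + 2 k, replacing [u n] by [u (k^2)] costs [L k], and
    replacing the denominator n by k^2 costs a relative error of at most
    2 / k. *)
Lemma cvg_along_squares (R : realType) (u g L : nat -> R) (mu : R) :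
  g n / n%:R @[n --> \oo] --> mu ->
  (((u (k * k)%N - g (k * k)%N) / (k * k)%:R) ^+ 2) @[k --> \oo] --> 0 ->
  ((L k / (k * k)%:R) ^+ 2) @[k --> \oo] --> 0 ->
  (forall k j, (j <= 2 * k)%N -> `|u (k * k + j)%N - u (k * k)%N| <= L k) ->
  u n / n%:R @[n --> \oo] --> mu.
Proof.
move=> gmu uA LB uL.
have sqr0 (v : nat -> R) : (v k ^+ 2) @[k --> \oo] --> 0 -> v k @[k --> \oo] --> 0.
  move=> /cvgrPdist_lt v0; apply/cvgrPdist_lt => e e0.
  have := v0 _ (exprn_gt0 2 e0); apply: filterS => k.
  by rewrite !sub0r !normrN normrX ltr_pXn2r ?nnegrE ?(ltW e0).
have {}uA := sqr0 _ uA; have {}LB := sqr0 _ LB.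
have sq_oo : (k * k)%N @[k --> \oo] --> \oo.
  by move=> A [N _ NA]; exists N => // k /= Nk; apply: NA => /=; nia.
have gsq : (g (k * k)%N / (k * k)%:R) @[k --> \oo] --> mu.
  exact: cvg_comp sq_oo gmu.
(* Dominates the distance from [u n / n] to [mu] for n in [k^2, k^2 + 2 k]. *)
pose r k := `|L k / (k * k)%:R| + `|(u (k * k)%N - g (k * k)%N) / (k * k)%:R| +
  `|g (k * k)%N / (k * k)%:R - mu| + `|mu| * (2 / k%:R).
have r0 : r k @[k --> \oo] --> 0.
  have n0 (v : nat -> R) : v k @[k --> \oo] --> 0 -> `|v k| @[k --> \oo] --> 0.
    by move=> v0; rewrite -(normr0 R); exact: cvg_norm.
  rewrite -(addr0 0) -[X in _ --> X + _](addr0 0).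
  rewrite -[X in _ --> X + _ + _](addr0 0) -[X in _ --> _ + X](mulr0 `|mu|).
  apply: cvgD; last by apply: cvgM; [exact: cvg_cst|exact: cvg_div_nat].
  apply: cvgD; first by apply: cvgD; exact: n0.
  by apply: n0; rewrite -(subrr mu); apply: cvgB => //; exact: cvg_cst.
move/cvgrPdist_lt : r0 => r0; apply/cvgrPdist_lt => e e0.
have [K _ KP] := r0 e e0.
exists (K * K + 1)%N => // n /= Kn.
have [k kn] := nat_sqrt_ex n.
have Kk : (K <= k)%N by nia.
have k0 : (0 < k)%N by nia.
have n0 : (0 < n)%N by lia.
have := KP k Kk; rewrite sub0r normrN; apply: le_lt_trans.
apply: le_trans (ler_norm _).
have := uL k (n - k * k)%N; rewrite subnKC; last by case/andP: kn.
move=> /(_ ltac:(lia)) un.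
have K20 : 0 < (k * k)%:R :> R by rewrite ltr0n; nia.
have N0 : 0 < n%:R :> R by rewrite ltr0n.
have k0R : 0 < k%:R :> R by rewrite ltr0n.
have K2n : (k * k)%:R <= n%:R :> R by rewrite ler_nat; lia.
have nK2 : n%:R - (k * k)%:R <= 2 * k%:R :> R.
  by rewrite lerBlDl -natrM -natrD ler_nat; lia.
have L0 : 0 <= L k by apply: le_trans un.
rewrite /r; set U := u (k * k)%N; set G := g (k * k)%N.
have -> : mu - u n / n%:R = - ((u n - U) / n%:R) -
    (((U - G) / (k * k)%:R + (G / (k * k)%:R - mu)) * ((k * k)%:R / n%:R)) +
    mu * ((n%:R - (k * k)%:R) / n%:R).
  by field; rewrite !gt_eqF.
apply: le_trans (ler_normD _ _) _; apply: lerD; last first.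
  rewrite normrM ler_wpM2l // ger0_norm; last by rewrite divr_ge0 // ?subr_ge0 // ltW.
  rewrite ler_pdivrMr // (le_trans nK2) // mulrAC ler_pdivlMr // -mulrA.
  by rewrite ler_wpM2l // -natrM.
apply: le_trans (ler_normB _ _) _; rewrite normrN -addrA; apply: lerD.
  rewrite normrM normfV (ger0_norm (ltW N0)) normrM normfV (ger0_norm (ltW K20)).
  rewrite (ger0_norm L0) ler_pM // ?invr_ge0 ?(ltW N0) //.
  by rewrite lef_pV2.
rewrite normrM; apply: le_trans (_ : `|(U - G) / (k * k)%:R + (G / (k * k)%:R - mu)| * 1 <= _).
  rewrite ler_wpM2l // ger0_norm ?divr_ge0 // ?(ltW N0) // ?(ltW K20) //.
  by rewrite ler_pdivrMr // mul1r.
by rewrite mulr1; exact: ler_normD.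
Qed.

(** * Mean and variance of the passage time *)

Section axis_time_variance.
Context (d : nat) (R : realType) disp (T : measurableType disp).
Variables (P : probability T R) (nu : set R -> \bar R).
Variable X : T -> config (edge d) R.
Hypothesis d_gt0 : (0 < d)%N.
Hypothesis iX : iid P nu X.
Hypothesis X0 : forall w e, 0 <= X w e.
Variable M : R.
Hypothesis M0 : 0 <= M.
Hypothesis XM : forall e, (\int[P]_w ((X w e) ^+ 2)%:E <= M%:E)%E.
Variables (q eps : R).
Hypotheses (q0 : 0 <= q) (q1 : q <= 1) (eps0 : 0 < eps).
Hypothesis nu_ge0 : (0 <= nu [set r | r < eps]%R)%E.
Hypothesis small : (nu [set r | r < eps]%R <= (q ^+ 2)%:E)%E.
Hypothesis dq : (2 * d)%:R * (2 * q) <= 1 / 4.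

Lemma measurable_weight_X h : measurable_fun setT (fun w => weight (X w) h).
Proof. by apply: measurable_sum => e; exact: iX.1. Qed.

Lemma integral_weight_le h :
  (\int[P]_w (weight (X w) h)%:E <= ((size h)%:R * (1 + M))%:E)%E.
Proof.
under eq_integral do rewrite /weight -sumEFin.
rewrite ge0_integral_sum //; last 2 first.
- by move=> e; apply/measurable_EFinP; exact: iX.1.
- by move=> e w _; rewrite lee_fin.
apply: (@le_trans _ _ (\sum_(e <- h) (1 + M)%:E)%E); last first.
  by rewrite sumEFin lee_fin big_const_seq iter_addr_0 count_predT mulr_natl.
apply: lee_sum => e _.
apply: (@le_trans _ _ (\int[P]_w (1 + ((X w e) ^+ 2)%:E))%E).
  apply: ge0_le_integral => //.
  - by move=> w _; rewrite lee_fin.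
  - by apply/measurable_EFinP; exact: iX.1.
  - apply: emeasurable_funD => //.
    by apply/measurable_EFinP/measurable_funX; exact: iX.1.
  - move=> w _; rewrite -EFinD lee_fin.
    by have := sqr_ge0 (X w e - 1); have := X0 w e; nra.
rewrite ge0_integralD //; last 2 first.
- by move=> w _; rewrite lee_fin sqr_ge0.
- by apply/measurable_EFinP/measurable_funX; exact: iX.1.
by rewrite integral_cst //= probability_setT mule1 EFinD leeD2l.
Qed.

Lemma integral_sqr_weight_le h :
  (\int[P]_w (weight (X w) h ^+ 2)%:E <= ((size h)%:R ^+ 2 * M)%:E)%E.
Proof.
apply: (@le_trans _ _
    (\int[P]_w ((size h)%:R%:E * \sum_(e <- h) (X w e ^+ 2)%:E))%E).
  apply: ge0_le_integral => //.
  - by move=> w _; rewrite lee_fin sqr_ge0.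
  - apply/measurable_EFinP/measurable_funX; exact: measurable_weight_X.
  - apply: measurable_funeM; apply: emeasurable_sum => e.
    by apply/measurable_EFinP/measurable_funX; exact: iX.1.
  - by move=> w _; rewrite sumEFin -EFinM lee_fin; exact: sqr_sum_le.
rewrite ge0_integralZl_EFin //; last 2 first.
- by move=> w _; apply: sume_ge0 => e _; rewrite lee_fin sqr_ge0.
- apply: emeasurable_sum => e.
  by apply/measurable_EFinP/measurable_funX; exact: iX.1.
rewrite ge0_integral_sum //; last 2 first.
- by move=> e; apply/measurable_EFinP/measurable_funX; exact: iX.1.
- by move=> e w _; rewrite lee_fin sqr_ge0.
rewrite expr2 -mulrA EFinM; apply: lee_wpmul2l => //.
apply: le_trans (lee_sum _ (fun e _ => XM e)) _.
by rewrite sumEFin lee_fin big_const_seq iter_addr_0 count_predT mulr_natl.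
Qed.

Let passage n w := axis_time (X w) n.

Lemma passage_ge0 n w : 0 <= passage n w.
Proof. exact: axis_time_ge0. Qed.

Lemma passage_le_line n w : passage n w <= weight (X w) (axis_line d_gt0 0 n).
Proof. exact: axis_time_le_line. Qed.

Let approx n N w :=
  fpt_approx (axis_line d_gt0 0 n) (axis_point d 0) (axis_point d n) N (X w).

Lemma cvg_approx n w : approx n N w @[N --> \oo] --> passage n w.
Proof. by apply: cvg_fpt_approx => //; exact: is_path_axis_line. Qed.

Lemma measurable_approx n N : measurable_fun setT (approx n N).
Proof.
exact: measurableT_comp (measurable_fpt_approx _ _ _ _) (measurable_iid iX).
Qed.

Lemma measurable_passage n : measurable_fun setT (passage n).
Proof.
apply: (measurable_fun_cvg (fun N => measurable_approx n N)) => w _.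
exact: cvg_approx.
Qed.

Definition var_bound (n : nat) : R :=
  2 * M * (2 / eps * (n%:R * (1 + M)) + 2).

(** The optimal path of a list that contains the straight line weighs at most
    as much as this line, so [path_size_le] bounds its mean size. *)
Lemma approx_two_copies_sqr_le n N :
  (\int[(P \x P)%E]_z ((approx n N z.1 - approx n N z.2) ^+ 2)%:E <=
   (var_bound n)%:E)%E.
Proof.
pose line := axis_line d_gt0 0 n.
pose ps := paths_upto (axis_point d 0) (axis_point d n) N.
have pl : is_path (axis_point d 0) (axis_point d n) line.
  exact: is_path_axis_line.
have ul : all uniq (line :: ps).
  apply/allP => h; rewrite inE => /orP[/eqP ->|/mem_paths_upto]; first by case: pl.
  by case.
apply: le_trans (variance_best_le iX X0 M0 XM ul) _.
rewrite /var_bound [leRHS]EFinM; apply: lee_wpmul2l.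
  by rewrite lee_fin mulr_ge0.
apply: (@le_trans _ _ (\int[P]_w ((2 / eps)%:E * (weight (X w) line)%:E +
    light_excess X eps (axis_point d 0) w))%E).
  apply: ge0_le_integral => //.
  - apply/measurable_EFinP.
    exact: (measurable_best_comp (fun h => (size h)%:R)) (measurable_iid iX).
  - apply: emeasurable_funD; last exact: (measurable_light_excess iX).
    by apply: measurable_funeM; apply/measurable_EFinP; exact: measurable_weight_X.
  - move=> w _; rewrite -EFinM.
    have pb : is_path (axis_point d 0) (axis_point d n) (best line ps (X w)).
      have := best_mem line ps (X w).
      by rewrite inE => /orP[/eqP ->|/mem_paths_upto].
    apply: le_trans (path_size_le X0 eps0 w pb) _.
    apply: leeD2r; rewrite lee_fin ler_wpM2l ?divr_ge0 ?(ltW eps0) //.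
    by apply: best_min; rewrite mem_head.
rewrite ge0_integralD //; last 4 first.
- move=> w _; rewrite -EFinM lee_fin mulr_ge0 ?divr_ge0 ?(ltW eps0) //.
  exact: weight_ge0.
- by apply: measurable_funeM; apply/measurable_EFinP; exact: measurable_weight_X.
- by move=> w _; exact: light_excess_ge0.
- exact: (measurable_light_excess iX).
rewrite EFinD; apply: leeD; last first.
  exact: (integral_light_excess_le iX X0 q0 q1 eps0 nu_ge0 small).
rewrite ge0_integralZl_EFin //; last 3 first.
- by move=> w _; rewrite lee_fin weight_ge0.
- by apply/measurable_EFinP; exact: measurable_weight_X.
- by rewrite divr_ge0 // ltW.
rewrite [leRHS]EFinM; apply: lee_wpmul2l; first by rewrite lee_fin divr_ge0 // ltW.
by apply: le_trans (integral_weight_le _) _; rewrite size_map size_iota.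
Qed.

Lemma passage_two_copies_sqr_le n :
  (\int[(P \x P)%E]_z ((passage n z.1 - passage n z.2) ^+ 2)%:E <= (var_bound n)%:E)%E.
Proof.
have mphi (phi : T -> R) : measurable_fun setT phi ->
    measurable_fun setT (fun z : T * T => ((phi z.1 - phi z.2) ^+ 2)%:E).
  move=> mphi; apply/measurable_EFinP/measurable_funX/measurable_funB.
    exact: measurableT_comp mphi measurable_fst.
  exact: measurableT_comp mphi measurable_snd.
apply: (@le_trans _ _ (\int[(P \x P)%E]_z
    limn_einf (fun N => ((approx n N z.1 - approx n N z.2) ^+ 2)%:E))%E).
  rewrite le_eqVlt; apply/orP; left; apply/eqP; apply: eq_integral => z _.
  apply/esym; apply: (cvg_limn_einf_sup _).1; apply: cvg_EFin.
    exact: nearW.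
  under eq_fun do rewrite expr2; rewrite expr2.
  by apply: cvgM; apply: cvgB; exact: cvg_approx.
apply: le_trans (fatou _ _ _ _) _ => //.
- by move=> N; apply: mphi; exact: measurable_approx.
- by move=> N z _; rewrite lee_fin sqr_ge0.
rewrite limn_einf_lim; apply: lime_le; first exact: is_cvg_einfs.
apply: nearW => N; apply: le_trans (approx_two_copies_sqr_le n N).
by apply: ereal_inf_lbound; exists N => /=.
Qed.

Lemma integral_passage_le n :
  (\int[P]_w (passage n w)%:E <= (n%:R * (1 + M))%:E)%E.
Proof.
apply: le_trans (_ : \int[P]_w (weight (X w) (axis_line d_gt0 0 n))%:E <= _)%E.
  apply: ge0_le_integral => //.
  - by move=> w _; rewrite lee_fin passage_ge0.
  - by apply/measurable_EFinP; exact: measurable_passage.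
  - by apply/measurable_EFinP; exact: measurable_weight_X.
  - by move=> w _; rewrite lee_fin passage_le_line.
by apply: le_trans (integral_weight_le _) _; rewrite size_map size_iota.
Qed.

Lemma integral_sqr_passage_le n :
  (\int[P]_w (passage n w ^+ 2)%:E <= (n%:R ^+ 2 * M)%:E)%E.
Proof.
apply: le_trans
  (_ : \int[P]_w (weight (X w) (axis_line d_gt0 0 n) ^+ 2)%:E <= _)%E.
  apply: ge0_le_integral => //.
  - by move=> w _; rewrite lee_fin sqr_ge0.
  - by apply/measurable_EFinP/measurable_funX; exact: measurable_passage.
  - by apply/measurable_EFinP/measurable_funX; exact: measurable_weight_X.
  - move=> w _; rewrite lee_fin lerXn2r ?nnegrE ?passage_ge0 ?passage_le_line //.
    exact: weight_ge0.
by apply: le_trans (integral_sqr_weight_le _) _; rewrite size_map size_iota.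
Qed.

Definition mean n : R := fine (\int[P]_w (passage n w)%:E)%E.

Lemma meanE n : (\int[P]_w (passage n w)%:E = (mean n)%:E)%E.
Proof.
rewrite /mean fineK // ge0_fin_numE.
  exact: le_lt_trans (integral_passage_le n) (ltry _).
by apply: integral_ge0 => w _; rewrite lee_fin passage_ge0.
Qed.

Lemma mean_ge0 n : 0 <= mean n.
Proof.
by rewrite -lee_fin -meanE; apply: integral_ge0 => w _; rewrite lee_fin passage_ge0.
Qed.

Lemma integrable_passage n : P.-integrable setT (EFin \o passage n).
Proof.
apply/integrableP; split; first by apply/measurable_EFinP; exact: measurable_passage.
under eq_integral do rewrite /= ger0_norm ?passage_ge0 //.
by rewrite meanE ltry.
Qed.

(** Conditionally on the first copy, Jensen's inequality replaces the second
    one by its mean. *)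
Lemma variance_passage_le n :
  (\int[P]_w ((passage n w - mean n) ^+ 2)%:E <= (var_bound n)%:E)%E.
Proof.
apply: le_trans (passage_two_copies_sqr_le n).
have mz : measurable_fun setT (fun z : T * T => ((passage n z.1 - passage n z.2) ^+ 2)%:E).
  apply/measurable_EFinP/measurable_funX/measurable_funB.
    exact: measurableT_comp (measurable_passage n) measurable_fst.
  exact: measurableT_comp (measurable_passage n) measurable_snd.
rewrite fubini_tonelli1 //; last by move=> z; rewrite lee_fin sqr_ge0.
apply: ge0_le_integral => //.
- by move=> w _; rewrite lee_fin sqr_ge0.
- apply/measurable_EFinP/measurable_funX/measurable_funB => //.
  exact: measurable_passage.
- apply: measurable_fun_fubini_tonelli_F => //.
  by move=> z; rewrite lee_fin sqr_ge0.
- by move=> w _; apply: jensen_sqr; [exact: integrable_passage|exact: meanE].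
Qed.

Let abs (tau : config (edge d) R) : config (edge d) R := fun e => `|tau e|.

(** For weights of any sign the infimum over all paths may fail to be the limit
    of the minima over finite lists. Absolute values extend the passage time
    of nonnegative weights to a function that is measurable on the whole space
    of configurations, as the transfer of laws requires. *)
Lemma measurable_axis_time_abs n :
  measurable_fun setT (fun tau => axis_time (abs tau) n).
Proof.
have mabs : measurable_fun setT abs.
  apply: measurable_config => e.
  exact: measurableT_comp (measurable_coord e).
pose a N tau := fpt_approx (axis_line d_gt0 0 n) (axis_point d 0)
  (axis_point d n) N (abs tau).
apply: (@measurable_fun_cvg _ _ _ _ a) => [N|tau _].
  exact: measurableT_comp (measurable_fpt_approx _ _ _ _) mabs.
apply: cvg_fpt_approx => [e|]; first exact: normr_ge0.
exact: is_path_axis_line.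
Qed.

Lemma measurable_passage_shift v n : measurable_fun setT
  (fun w => axis_time (fun e => X w (shift_edge v e)) n).
Proof.
rewrite (_ : (fun w => _) = fun w =>
    axis_time (abs (fun e => X w (shift_edge v e))) n); last first.
  apply/funext => w; congr (axis_time _ _).
  by apply/funext => e; rewrite /abs ger0_norm.
apply: (measurableT_comp (measurable_axis_time_abs n)).
by apply: measurable_config => e; exact: iX.1.
Qed.

Lemma mean_shift v n :
  (\int[P]_w (axis_time (fun e => X w (shift_edge v e)) n)%:E = (mean n)%:E)%E.
Proof.
pose F tau := (axis_time (abs tau) n)%:E.
have absX w : abs (X w) = X w by apply/funext => e; rewrite /abs ger0_norm.
rewrite -meanE.
transitivity (\int[P]_w F (fun e => X w (shift_edge v e)))%E.
  apply: eq_integral => w _; rewrite /F; congr (axis_time _ _)%:E.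
  by apply/funext => e; rewrite /abs ger0_norm.
rewrite (iid_integral_reindex (@shift_edgeK d v) iX).
- by apply: eq_integral => w _; rewrite /F absX.
- by apply/measurable_EFinP; exact: measurable_axis_time_abs.
- by move=> tau; rewrite lee_fin; apply: axis_time_ge0 => e; exact: normr_ge0.
Qed.

Lemma mean_subadditive m n : mean (m + n) <= mean m + mean n.
Proof.
rewrite -lee_fin EFinD -2!meanE -(mean_shift (axis_point d m)).
have mS : measurable_fun setT
    (fun w => (axis_time (fun e => X w (shift_edge (axis_point d m) e)) n)%:E).
  by apply/measurable_EFinP; exact: measurable_passage_shift.
rewrite -ge0_integralD //.
- apply: ge0_le_integral => //.
  + by move=> w _; rewrite lee_fin passage_ge0.
  + by apply/measurable_EFinP; exact: measurable_passage.
  + by apply: emeasurable_funD => //; apply/measurable_EFinP; exact: measurable_passage.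
  + by move=> w _; rewrite -EFinD lee_fin axis_time_subadditive.
- by move=> w _; rewrite lee_fin passage_ge0.
- by apply/measurable_EFinP; exact: measurable_passage.
- by move=> w _; rewrite lee_fin axis_time_ge0.
Qed.

(** A path to (n, 0) has at least [n] edges; take the infimum of the weight in
    [path_size_le], then the mean. *)
Lemma mean_lower n : n%:R <= 2 / eps * mean n + 2.
Proof.
have c0 : 0 <= 2 / eps by rewrite divr_ge0 // ltW.
have lw w : (n%:R%:E <= (2 / eps)%:E * (passage n w)%:E +
    light_excess X eps (axis_point d 0) w)%E.
  apply/lee_addgt0Pr => delta d0.
  (* The factor 2 / eps of [path_size_le] turns this into [delta]. *)
  have e20 : 0 < eps / 2 * delta by rewrite !mulr_gt0.
  have [h ph lt] :=
    fpt_adherent (X0 w) (proj2 (is_path_axis_line d_gt0 n)) e20.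
  apply: (@le_trans _ _ ((size h)%:R)%:E).
    by rewrite lee_fin ler_nat; apply: size_axis_path d_gt0 _ _ (proj2 ph).
  apply: le_trans (path_size_le X0 eps0 w ph) _.
  rewrite addeAC; apply: leeD2r; rewrite -EFinM -EFinD lee_fin.
  apply: le_trans (ler_wpM2l c0 (ltW lt)) _; rewrite mulrDr lerD2l.
  rewrite mulrA -[2 / eps * _]mulrA [_^-1 * _]mulrA mulVf ?gt_eqF // mul1r.
  by rewrite divff // mul1r.
rewrite -lee_fin EFinD EFinM -meanE.
apply: (@le_trans _ _ (\int[P]_w ((2 / eps)%:E * (passage n w)%:E +
    light_excess X eps (axis_point d 0) w))%E).
  rewrite -[leLHS]mule1 -(probability_setT P) -integral_cst //.
  apply: ge0_le_integral => //; first by move=> w _; rewrite lee_fin.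
  apply: emeasurable_funD; last exact: (measurable_light_excess iX).
  by apply: measurable_funeM; apply/measurable_EFinP; exact: measurable_passage.
rewrite ge0_integralD //; last 4 first.
- by move=> w _; rewrite -EFinM lee_fin mulr_ge0 // passage_ge0.
- by apply: measurable_funeM; apply/measurable_EFinP; exact: measurable_passage.
- by move=> w _; exact: light_excess_ge0.
- exact: (measurable_light_excess iX).
apply: leeD; last first.
  exact: (integral_light_excess_le iX X0 q0 q1 eps0 nu_ge0 small).
rewrite ge0_integralZl_EFin //.
- by move=> w _; rewrite lee_fin passage_ge0.
- by apply/measurable_EFinP; exact: measurable_passage.
Qed.

(** The lower bound [eps / 4] comes from [mean_lower], whose additive constant
    is at most n / 2 for n >= 4. *)
Lemma mean_cvg :
  exists2 mu : R, 0 < mu & mean n / n%:R @[n --> \oo] --> mu.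
Proof.
have /cvg_ex[mu muP] := fekete mean_ge0 mean_subadditive.
exists mu => //; apply: (@lt_le_trans _ _ (eps / 4)); first by rewrite divr_gt0.
apply: (cvgr_to_ge muP); exists 4%N => // n /= n4.
have n0 : 0 < n%:R :> R by rewrite ltr0n; lia.
have n4R : 4 <= n%:R :> R by rewrite ler_nat.
rewrite ler_pdivlMr // mulrAC ler_pdivrMr //.
have h := mean_lower n.
have : eps * n%:R <= eps * (2 / eps * mean n + 2) by rewrite ler_pM2l.
have -> : eps * (2 / eps * mean n + 2) = 2 * mean n + 2 * eps.
  by field; rewrite gt_eqF.
have : eps * 4 <= eps * n%:R by rewrite ler_pM2l.
by move: (eps * n%:R) => x; lra.
Qed.

Definition var_rate : R := 2 * M * (2 / eps * (1 + M) + 2).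

Lemma var_rate_ge0 : 0 <= var_rate.
Proof.
have c0 : 0 <= 2 / eps by rewrite divr_ge0 // ltW.
by rewrite /var_rate !mulr_ge0 // addr_ge0 // mulr_ge0 // addr_ge0.
Qed.

(** A second moment that grows linearly; both sides vanish for [n = 0] by the
    convention on division by zero. *)
Lemma integral_div_sqr_le (Y : T -> R) (c : R) (n : nat) :
  measurable_fun setT Y -> (\int[P]_w ((Y w) ^+ 2)%:E <= (n%:R * c)%:E)%E ->
  (\int[P]_w ((Y w / n%:R) ^+ 2)%:E <= (c / n%:R)%:E)%E.
Proof.
move=> mY Yc.
have -> : (\int[P]_w ((Y w / n%:R) ^+ 2)%:E =
    (n%:R ^- 2)%:E * \int[P]_w ((Y w) ^+ 2)%:E)%E.
  rewrite -ge0_integralZl_EFin //.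
  - by apply: eq_integral => w _; rewrite -EFinM expr_div_n mulrC.
  - by move=> w _; rewrite lee_fin sqr_ge0.
  - exact/measurable_EFinP/measurable_funX.
apply: (@le_trans _ _ ((n%:R ^- 2)%:E * (n%:R * c)%:E)%E).
  by apply: lee_wpmul2l => //; rewrite lee_fin invr_ge0 exprn_ge0.
rewrite -EFinM lee_fin; case: n {Yc} => [|n].
  by rewrite expr2 !(mul0r, invr0, mulr0).
by rewrite le_eqVlt; apply/orP; left; apply/eqP; field; rewrite lt0r_neq0.
Qed.

Lemma variance_mean_div_le n :
  (\int[P]_w (((passage n w - mean n) / n%:R) ^+ 2)%:E <= (var_rate / n%:R)%:E)%E.
Proof.
have mT : measurable_fun setT (fun w => passage n w - mean n).
  by apply: measurable_funB => //; exact: measurable_passage.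
case: n mT => [|n] mT.
  rewrite [leRHS](_ : _ = 0%E); last by rewrite invr0 mulr0.
  rewrite le_eqVlt; apply/orP; left; apply/eqP; apply: integral0_eq => w _.
  by rewrite invr0 mulr0 expr0n.
apply: integral_div_sqr_le => //; apply: le_trans (variance_passage_le _) _.
rewrite lee_fin /var_bound /var_rate.
have c0 : 0 <= 2 / eps by rewrite divr_ge0 // ltW.
rewrite [leRHS]mulrCA ler_wpM2l ?mulr_ge0 // [leRHS]mulrDr; apply: lerD.
  by rewrite [leRHS]mulrCA.
by rewrite -[leLHS]mul1r ler_wpM2r // ler1n.
Qed.

(** Two applications of [ae_cvg0_summable] to variables with mean O(k^-2):
    the fluctuation of the passage time at k^2, and the weight of the segment
    from k^2 to k^2 + 2 k divided by k^2. *)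
Lemma ae_cvg_passage (mu : R) : mean n / n%:R @[n --> \oo] --> mu ->
  {ae P, forall w, passage n w / n%:R @[n --> \oo] --> mu}.
Proof.
move=> muP.
pose L k w := weight (X w) (axis_line d_gt0 (k * k) (2 * k)).
have mT n : measurable_fun setT (fun w => passage n w - mean n).
  by apply: measurable_funB => //; exact: measurable_passage.
have bound (c : R) : 0 <= c -> forall n,
    \sum_(0 <= k < n) c / (k * k)%:R <= c * 2.
  by move=> c0 n; rewrite -mulr_sumr ler_wpM2l // sum_inv_sqr_le.
have aeT : {ae P, forall w,
    ((passage (k * k) w - mean (k * k)) / (k * k)%:R) ^+ 2 @[k --> \oo] --> 0}.
  apply: (ae_cvg0_summable (c := fun k => var_rate / (k * k)%:R)
    (C := var_rate * 2)).
  - by move=> k; apply: measurable_funX; apply: measurable_funM => //.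
  - by move=> k w; exact: sqr_ge0.
  - by move=> k; exact: variance_mean_div_le.
  - exact: bound var_rate_ge0.
have aeL : {ae P, forall w, (L k w / (k * k)%:R) ^+ 2 @[k --> \oo] --> 0}.
  apply: (ae_cvg0_summable (c := fun k => 4 * M / (k * k)%:R)
    (C := 4 * M * 2)).
  - move=> k; apply: measurable_funX; apply: measurable_funM => //.
    exact: measurable_weight_X.
  - by move=> k w; exact: sqr_ge0.
  - move=> k; apply: integral_div_sqr_le; first exact: measurable_weight_X.
    apply: le_trans (integral_sqr_weight_le _) _.
    rewrite size_map size_iota lee_fin !natrM.
    by rewrite le_eqVlt; apply/orP; left; apply/eqP; ring.
  - by apply: bound; rewrite mulr_ge0.
apply: filterS2 aeT aeL => w Tw Lw.
apply: cvg_along_squares muP Tw Lw _ => k j jk.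
apply: le_trans (axis_time_dist d_gt0 (k * k) j (X0 w)) _.
rewrite /L -(subnKC jk) /axis_line iotaD map_cat weight_cat lerDl.
exact: weight_ge0.
Qed.

Lemma Lfun_passage n : (fun w => passage n w / n%:R) \in Lfun P 2%:E.
Proof.
have mT : measurable_fun setT (fun w => passage n w / n%:R).
  by apply: measurable_funM => //; exact: measurable_passage.
rewrite inE; apply/andP; split; rewrite inE //=.
rewrite /finite_norm unlock poweR_lty //.
apply: (@le_lt_trans _ _ (n%:R * M / n%:R)%:E); last exact: ltry.
apply: le_trans (_ : \int[P]_w ((passage n w / n%:R) ^+ 2)%:E <= _)%E.
  rewrite le_eqVlt; apply/orP; left; apply/eqP; apply: eq_integral => w _.
  by rewrite /= powR_mulrn // real_normK // num_real.
apply: integral_div_sqr_le; first exact: measurable_passage.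
by apply: le_trans (integral_sqr_passage_le _) _; rewrite expr2 mulrA.
Qed.

(** The mean square of the error is at most twice the variance, which is
    O(1 / n), plus twice the square of the error on the mean. *)
Lemma Lnorm_passage_cvg (mu : R) : mean n / n%:R @[n --> \oo] --> mu ->
  ('N[P]_2%:E[EFin \o ((fun w => passage n w / n%:R) \- (fun=> mu))%R])%E
    @[n --> \oo] --> 0%E.
Proof.
move=> muP.
pose s n := 2 * (var_rate / n%:R) + 2 * (mean n / n%:R - mu) ^+ 2.
have s0 n : 0 <= s n.
  by rewrite addr_ge0 // mulr_ge0 ?sqr_ge0 // divr_ge0 // var_rate_ge0.
have scvg : s n @[n --> \oo] --> 0.
  have d0 : mean n / n%:R - mu @[n --> \oo] --> 0.
    by rewrite -(subrr mu); apply: cvgB => //; exact: cvg_cst.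
  have h1 := cvgM (cvg_cst (2 : R)) (cvg_div_nat var_rate).
  have h2 := cvgM (cvg_cst (2 : R)) (cvgM d0 d0).
  by have := cvgD (h1 _ _) (h2 _ _ _); rewrite !mulr0 addr0; exact.
have sq n : (\int[P]_w ((passage n w / n%:R - mu) ^+ 2)%:E <= (s n)%:E)%E.
  have mD : measurable_fun setT
      (fun w => (((passage n w - mean n) / n%:R) ^+ 2)%:E).
    apply/measurable_EFinP/measurable_funX/measurable_funM => //.
    by apply: measurable_funB => //; exact: measurable_passage.
  apply: (@le_trans _ _ (\int[P]_w (2%:E * (((passage n w - mean n) / n%:R) ^+ 2)%:E +
      (2 * (mean n / n%:R - mu) ^+ 2)%:E))%E).
    apply: ge0_le_integral => //.
    - by move=> w _; rewrite lee_fin sqr_ge0.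
    - apply/measurable_EFinP/measurable_funX/measurable_funB => //.
      by apply: measurable_funM => //; exact: measurable_passage.
    - by apply: emeasurable_funD => //; exact: measurable_funeM.
    - move=> w _; rewrite -EFinM -EFinD lee_fin mulrBl.
      move: (passage n w / _) (mean n / _) => x y.
      by have := sqr_ge0 (x - y - (y - mu)); nra.
  rewrite ge0_integralD //; last 3 first.
  - by move=> w _; rewrite -EFinM lee_fin mulr_ge0 // sqr_ge0.
  - exact: measurable_funeM.
  - by move=> w _; rewrite lee_fin mulr_ge0 // sqr_ge0.
  rewrite integral_cst //= probability_setT mule1 /s [leRHS]EFinD; apply: leeD => //.
  rewrite ge0_integralZl_EFin //; last by move=> w _; rewrite lee_fin sqr_ge0.
  by rewrite [leRHS]EFinM; apply: lee_wpmul2l => //; exact: variance_mean_div_le.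
apply: (@squeeze_cvge _ _ _ _ (fun=> 0%E) _ (fun n => (Num.sqrt (s n))%:E)).
- apply: nearW => n; rewrite Lnorm_ge0 /= unlock -powR12_sqrt // -poweR_EFin.
  rewrite gt0_ler_poweR //.
  + by rewrite in_itv /= leey andbT integral_ge0.
  + by rewrite in_itv /= leey andbT lee_fin s0.
  apply: le_trans (sq n); rewrite le_eqVlt; apply/orP; left; apply/eqP.
  apply: eq_integral => w _.
  by rewrite /= powR_mulrn // real_normK // num_real.
- exact: cvg_cst.
- apply: cvg_EFin; first exact: nearW.
  rewrite -(sqrtr0 R); apply: (cvg_comp _ _ scvg).
  exact: sqrt_continuous.
Qed.

End axis_time_variance.

(** * Convergence *)

Lemma iid_of_family (d : nat) (R : realType) disp (T : measurableType disp)
    (P : probability T R) (t : edge d -> {RV P >-> R}) (e0 : edge d) :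
  mutually_independent t -> identically_distributed t ->
  iid P (distribution P (t e0)) (fun w e => t e w : R).
Proof.
move=> ind idt; split=> [e|s B us mB]; first exact: measurable_funPT.
rewrite (ind s B us mB); apply: eq_bigr => e _.
exact: idt.
Qed.

(** Turns the moment hypothesis into a bound on second moments. *)
Lemma sqr_le_powR (R : realType) (x p : R) : 0 <= x -> 2 <= p ->
  x ^+ 2 <= 1 + x `^ p.
Proof.
move=> x0 p2; have [x1|x1] := leP x 1.
  apply: (@le_trans _ _ 1); last by rewrite lerDl powR_ge0.
  by rewrite expr_le1.
rewrite -powR_mulrn //; apply: le_trans (ler_powR (ltW x1) p2) _.
by rewrite lerDr.
Qed.

Lemma small_values (R : realType) (F : R -> \bar R) (a : R) : 0 < a ->
  F eps @[eps --> 0^'+] --> 0%E ->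
  exists2 eps, 0 < eps & (F eps <= a%:E)%E.
Proof.
move=> a0 /fine_cvgP[Ffin /cvgrPdist_lt/(_ a a0) Fa].
have : \forall eps \near 0^'+, 0 < eps /\ (F eps <= a%:E)%E.
  near=> eps; split; first by near: eps; exact: nbhs_right_gt.
  have fin : F eps \is a fin_num by near: eps.
  rewrite -(fineK fin) lee_fin; apply/ltW.
  have : `|0 - (fine \o F) eps| < a by near: eps.
  by rewrite sub0r normrN => /ltr_normlW.
by move=> /filter_ex[eps []]; exists eps.
Unshelve. all: by end_near.
Qed.

Unset Implicit Arguments.

Theorem corollary2 (R : realType) (disp : measure_display)
    (Omega : measurableType disp) (P : probability Omega R)
    (d : nat) (d_ge2 : (2 <= d)%N)
    (t : edge d -> {RV P >-> R})
    (t_ge0 : forall (e : edge d) (w : Omega), 0 <= t e w)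
    (t_indep : mutually_independent t)
    (t_ident : identically_distributed t)
    (t_small : ereal_sup [set P [set w | t e w < eps] | e in [set: edge d]]
                 @[eps --> 0^'+] --> 0%E)
    (t_moment : exists2 eta : R, 0 < eta &
       (ereal_sup [set 'E_P[fun w => (t e w `^ (6 * (1 + d)%:R + eta))%R]
                  | e in [set: edge d]] < +oo)%E) :
  exists mu : R, [/\ 0 < mu,
    cvg_almost_surely P (fun n w => passage_time t n w / n%:R) (fun=> mu) &
    cvg_L2 P (fun n w => passage_time t n w / n%:R) (fun=> mu)].
Proof.
have d_gt0 : (0 < d)%N by apply: leq_trans d_ge2.
pose e0 : edge d := (0, Ordinal d_gt0).
have iX := iid_of_family e0 t_indep t_ident.
have X0 (w : Omega) (e : edge d) : 0 <= t e w by exact: t_ge0.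
have [eta eta0] := t_moment; set p := _ + eta; set K := ereal_sup _ => Koo.
have K0 : (0 <= K)%E.
  apply: le_trans (ereal_sup_ubound _); last by exists e0.
  by apply: expectation_ge0 => w; exact: powR_ge0.
have p2 : 2 <= p.
  rewrite /p; have : 0 <= (1 + d)%:R :> R by [].
  have : 1 <= (1 + d)%:R :> R by rewrite ler1n.
  by lra.
pose M := 1 + fine K.
have M0 : 0 <= M by rewrite addr_ge0 // fine_ge0.
have XM (e : edge d) : (\int[P]_w ((t e w) ^+ 2)%:E <= M%:E)%E.
  have mp : measurable_fun setT (fun w => (t e w `^ p)%:E).
    apply/measurable_EFinP.
    exact: (measurableT_comp (measurable_powR p)) (measurable_funPT (t e)).
  apply: (@le_trans _ _ (\int[P]_w (1 + (t e w `^ p)%:E))%E).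
    apply: ge0_le_integral => //.
    - by move=> w _; rewrite lee_fin sqr_ge0.
    - by apply/measurable_EFinP/measurable_funX; exact: measurable_funPT.
    - exact: emeasurable_funD.
    - by move=> w _; rewrite -EFinD lee_fin sqr_le_powR.
  rewrite ge0_integralD //; last by move=> w _; rewrite lee_fin powR_ge0.
  rewrite integral_cst //= probability_setT mule1 /M EFinD leeD2l //.
  rewrite fineK ?ge0_fin_numE //.
  apply: le_trans (ereal_sup_ubound _); last by exists e.
  by rewrite unlock.
have dR : 1 <= d%:R :> R by rewrite ler1n.
(* Chosen so that (2 d) (2 q) = 1 / 4 in the Peierls estimate. *)
pose q : R := 1 / (16 * d%:R).
have q_gt0 : 0 < q by rewrite divr_gt0 // mulr_gt0 //; lra.
have q1 : q <= 1.
  by rewrite /q ler_pdivrMr ?mul1r; lra.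
have dq : (2 * d)%:R * (2 * q) <= 1 / 4.
  rewrite natrM /q le_eqVlt; apply/orP; left; apply/eqP; field.
  by rewrite pnatr_eq0 -lt0n.
have [eps eps0 Feps] := small_values (exprn_gt0 2 q_gt0) t_small.
have small : (distribution P (t e0) [set r | r < eps]%R <= (q ^+ 2)%:E)%E.
  apply: le_trans Feps; apply: ereal_sup_ubound; exists e0 => //.
have nu_ge0 : (0 <= distribution P (t e0) [set r | r < eps]%R)%E by [].
have [mu mu0 muP] := mean_cvg d_gt0 iX X0 M0 XM (ltW q_gt0) q1 eps0 nu_ge0 small dq.
exists mu; split => //.
- exact: (ae_cvg_passage d_gt0 iX X0 M0 XM (ltW q_gt0) q1 eps0 nu_ge0 small dq muP).
- split.
  + by move=> n; have := Lfun_passage d_gt0 iX X0 XM n; exact.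
  + exact: Lfun_cst.
  + exact: (Lnorm_passage_cvg d_gt0 iX X0 M0 XM (ltW q_gt0) q1 eps0 nu_ge0 small dq muP).
Qed.
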